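(* Let $E\subset\mathbb R^2$ be a totally disconnected Lalley-Gatzouras set with data $m$, $(n_i)$, $(b_i)$, $(a_{ij})$, $(c_{ij})$ such that $n_i=0$ for some $i\in\{1,2,\dots,m\}$. Let $\{\alpha_k\}_{k}$ be the gap sequence of $E$ and let $\dim_B E$ be the box dimension of $E$. Then $\alpha_k\asymp k^{-1/\dim_B E}$, that is, there exists a constant $c>1$ such that $c^{-1}k^{-1/\dim_B E}\le\alpha_k\le c\,k^{-1/\dim_B E}$ for all $k$.
   Context: Lalley-Gatzouras sets. Let $m\ge 2$ and $n_i\ge 0$ ($i=1,\dots,m$) be integers. Let $b_i>0$ ($i=1,\dots,m$) be real numbers with $\sum_{i=1}^m b_i=1$. Put $d_1=0$ and $d_i=b_1+\dots+b_{i-1}$ for $2\le i\le m$. Let $\mathcal D=\{(i,j): 1\le i\le m,\ n_i>0,\ 1\le j\le n_i\}$, assumed nonempty. Let $(a_{ij})_{(i,j)\in\mathcal D}$ and $(c_{ij})_{(i,j)\in\mathcal D}$ be nonnegative real numbers such that $1>b_i>a_{ij}>0$ for each $(i,j)\in\mathcal D$; $\sum_{j=1}^{n_i}a_{ij}\le 1$ for each $i$; $c_{i(j+1)}-c_{ij}\ge a_{ij}$ whenever $(i,j),(i,j+1)\in\mathcal D$; and $1-c_{in_i}\ge a_{in_i}$ for each $i$ with $n_i>0$. For $(i,j)\in\mathcal D$ define $S_{ij}:\mathbb R^2\to\mathbb R^2$ by $S_{ij}(x,y)=(a_{ij}x+c_{ij},\,b_iy+d_i)$. The Lalley-Gatzouras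 set $E$ is the attractor of $\{S_{ij}\}_{(i,j)\in\mathcal D}$, i.e. the unique nonempty compact set with $E=\bigcup_{(i,j)\in\mathcal D}S_{ij}(E)$. Box dimension. It is known (Lalley and Gatzouras) that the box dimension of $E$ equals the real number $s$ determined by $\sum_{i:\,n_i\neq0}\sum_{j=1}^{n_i}b_i^{s_1}a_{ij}^{s-s_1}=1$, where $s_1$ is the unique real number with $\sum_{i:\,n_i\ne0}b_i^{s_1}=1$. Gap sequence. Let $A\subset\mathbb R^2$ be compact and $\delta>0$. Points $x,y\in A$ are $\delta$-equivalent if $x=y$ or there is a finite sequence $a_0=x,a_1,\dots,a_k=y$ of points of $A$ with $|a_{i+1}-a_i|\le\delta$ for $i=0,\dots,k-1$. Let $\mathfrak N(\delta)$ be the number of $\delta$-equivalence classes of $A$; it is non-increasing in $\delta$. Write $\mathfrak N(\delta^-)=\lim_{h\to0^+}\mathfrak N(\delta-h)$. The gap sequence $\{\alpha_k\}_{k\ge1}$ of $A$ is the sequence consisting of the jump points of $\mathfrak N$, listed as $\delta$ decreases, with multiplicity: a value $\delta$ occurs in the sequence if and only if $\mathfrak N(\delta)<\mathfrak N(\delta^-)$, and then $\operatorname{card}\{k:\alpha_k=\delta\}=\mathfrak N(\delta^-)-\mathfrak N(\delta)$. *)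

(* Defs.v *)
From HB Require Import structures.
From mathcomp Require Import all_boot all_order all_algebra finmap.
From mathcomp Require Import all_classical all_reals all_analysis.

Set Implicit Arguments.
Unset Strict Implicit.
Unset Printing Implicit Defensive.

Import Order.TTheory GRing.Theory Num.Theory.
Import numFieldNormedType.Exports.

Local Open Scope classical_set_scope.
Local Open Scope card_scope.
Local Open Scope ring_scope.

(* The library norm on R * R is the sup norm, hence this Euclidean distance.
   Both induce the product topology, so the library's [compact] and
   [totally_disconnected] are the usual notions. *)
Definition eucl_dist (R : realType) (p q : R * R) : R :=
  Num.sqrt ((p.1 - q.1) ^+ 2 + (p.2 - q.2) ^+ 2).

(* Rows and columns are numbered from 0: row i : 'I_m stands for i.+1, and
   j : 'I_(n i) for j.+1, so that the index set D is {i : 'I_m & 'I_(n i)}. *)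
Record lg_data (R : realType) (m : nat) (n : 'I_m -> nat) (b : 'I_m -> R)
    (a c : forall i : 'I_m, 'I_(n i) -> R) : Prop := LGData {
  lg_m_ge2 : (2 <= m)%N ;
  lg_b_gt0 : forall i, 0 < b i ;
  lg_b_sum1 : \sum_(i < m) b i = 1 ;
  lg_nonempty : exists i, (0 < n i)%N ;
  lg_a_ge0 : forall i (j : 'I_(n i)), 0 <= a i j ;
  lg_c_ge0 : forall i (j : 'I_(n i)), 0 <= c i j ;
  lg_ab : forall i (j : 'I_(n i)), [/\ b i < 1, a i j < b i & 0 < a i j] ;
  lg_a_sum : forall i, \sum_(j < n i) a i j <= 1 ;
  lg_c_step : forall i (j j' : 'I_(n i)), j' = j.+1 :> nat ->
    a i j <= c i j' - c i j ;
  lg_c_last : forall i (j : 'I_(n i)), j.+1 = n i -> a i j <= 1 - c i j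
}.

Definition lg_offset (R : realType) (m : nat) (b : 'I_m -> R) (i : 'I_m) : R :=
  \sum_(k < m | (k < i)%N) b k.

Definition lg_map (R : realType) (m : nat) (n : 'I_m -> nat) (b : 'I_m -> R)
    (a c : forall i : 'I_m, 'I_(n i) -> R) (i : 'I_m) (j : 'I_(n i))
    (p : R * R) : R * R :=
  (a i j * p.1 + c i j, b i * p.2 + lg_offset b i).

Definition lg_set (R : realType) (m : nat) (n : 'I_m -> nat) (b : 'I_m -> R)
    (a c : forall i : 'I_m, 'I_(n i) -> R) (E : set (R * R)) : Prop :=
  [/\ E !=set0, compact E &
      E = \bigcup_(i in [set: 'I_m]) \bigcup_(j in [set: 'I_(n i)])
            (lg_map b a c j @` E)].

(* Smallest number of sets of diameter at most delta covering A. The infimum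
   is over real casts of naturals, hence attained when A is bounded. *)
Definition cover_number (R : realType) (A : set (R * R)) (delta : R) : R :=
  inf [set N%:R | N in [set N : nat | exists U : 'I_N -> set (R * R),
    (forall i p q, U i p -> U i q -> eucl_dist p q <= delta) /\
    A `<=` \bigcup_(i in [set: 'I_N]) U i]].

Definition box_dim (R : realType) (A : set (R * R)) : R :=
  lim ((ln (cover_number A delta) / - ln delta) @[delta --> (0 : R)^'+]).

(* The empty chain s = [::] gives the case x = y. *)
Definition delta_equiv (R : realType) (A : set (R * R)) (delta : R)
    (x y : R * R) : Prop :=
  [/\ A x, A y & exists s : seq (R * R),
    [/\ forall z, z \in s -> A z,
        path (fun p q => eucl_dist q p <= delta) x s & last x s = y]].

(* [fset_set] returns the empty set on infinite sets; for compact A and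
   delta > 0 the set of classes is finite. *)
Definition class_number (R : realType) (A : set (R * R)) (delta : R) : nat :=
  #|` fset_set [set [set y | delta_equiv A delta x y] | x in A] |%fset.

(* A limit in the discrete space nat. *)
Definition class_number_left (R : realType) (A : set (R * R)) (delta : R)
    : nat :=
  lim (class_number A (delta - h) @[h --> (0 : R)^'+]).

(* [K] is the set of indices of the sequence, an initial segment of the positive
   integers: it is finite when A has finitely many gaps. The values of [alpha]
   outside [K] are irrelevant. *)
Record gap_sequence (R : realType) (A : set (R * R)) (K : set nat)
    (alpha : nat -> R) : Prop := GapSequence {
  gap_index_gt0 : forall k, K k -> (0 < k)%N ;
  gap_index_initial : forall j k, (0 < j <= k)%N -> K k -> K j ;
  gap_gt0 : forall k, K k -> 0 < alpha k ;
  gap_noninc : forall j k, K j -> K k -> (j <= k)%N -> alpha k <= alpha j ;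
  gap_jump : forall delta : R, 0 < delta ->
    (exists2 k, K k & alpha k = delta) <->
    (class_number A delta < class_number_left A delta)%N ;
  gap_mult : forall delta : R, 0 < delta ->
    (class_number A delta < class_number_left A delta)%N ->
    [set k | K k /\ alpha k = delta] #=
      `I_(class_number_left A delta - class_number A delta)
}.

(* Main.v *)
Require Import Defs.
From HB Require Import structures.
From mathcomp Require Import all_boot all_order all_algebra finmap.
From mathcomp Require Import all_classical all_reals all_analysis.
From mathcomp Require Import ring lra.
Import Order.TTheory GRing.Theory Num.Theory.
Import numFieldNormedType.Exports.
Local Open Scope classical_set_scope.
Local Open Scope ring_scope.
Set Implicit Arguments.
Unset Strict Implicit.
Unset Printing Implicit Defensive.

(* Writing N(delta) for the number of delta-classes, monotonicity and
   right-continuity of N give N(alpha_k) <= k <= N(alpha_k^-) <= N(alpha_k / 2),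
   so it suffices to show that N(delta) is comparable to delta^-s. Fix s1 and t
   with sum_i b_i^s1 = 1 and sum_ij b_i^s1 a_ij^t = 1, and put s = s1 + t.

   Covering E by boxes of width al and height beta <= al and pulling back along
   the maps S_ij gives the recursion M(al, beta) <= sum_ij M(al/a_ij, beta/b_i),
   hence M(al, beta) <= C al^-t beta^-s1 and N(delta) <= M(delta/4, delta/4).

   For the lower bound, the empty row yields a piece of the projection of E to
   the vertical axis that is isolated from the rest; its images under words of
   rows of height about delta are cells that no delta-chain can leave. No row
   fills [0, 1], since E is totally disconnected, so inside a cell every
   rectangle of width about delta has a horizontal gap and a point of E to the
   left, or to the right, of it. Points of the same side lying in distinct
   rectangles are separated by these gaps. The same recursion shows that there
   are at least c delta^-s rectangles in all, and one of the two sides accounts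
   for half of them. Both bounds together identify s with the box dimension. *)

(** * Classes and gap sequences *)

Section ClassNumber.
Context {R : realType}.
Implicit Types (A : set (R * R)) (p q x y : R * R) (delta : R).

Lemma eucl_distC p q : eucl_dist p q = eucl_dist q p.
Proof. by rewrite /eucl_dist -sqrrN opprB -[(p.2 - _) ^+ 2]sqrrN opprB. Qed.

Lemma eucl_dist_ge1 p q : `|p.1 - q.1| <= eucl_dist p q.
Proof. by rewrite -sqrtr_sqr ler_wsqrtr// lerDl sqr_ge0. Qed.

Lemma eucl_dist_ge2 p q : `|p.2 - q.2| <= eucl_dist p q.
Proof. by rewrite -sqrtr_sqr ler_wsqrtr// lerDr sqr_ge0. Qed.

Lemma eucl_dist_le_sum p q : eucl_dist p q <= `|p.1 - q.1| + `|p.2 - q.2|.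
Proof.
set u := p.1 - _; set v := p.2 - _.
rewrite -[leRHS](ger0_norm (addr_ge0 (normr_ge0 u) (normr_ge0 v))).
rewrite -(sqrtr_sqr (`|u| + `|v|)) ler_wsqrtr// -/u -/v.
rewrite -(real_normK (num_real u)) -(real_normK (num_real v)) sqrrD.
by rewrite lerD2r lerDl mulrn_wge0// mulr_ge0.
Qed.

Lemma delta_equiv_refl A delta x : A x -> delta_equiv A delta x x.
Proof. by move=> Ax; split=> //; exists [::]. Qed.

Lemma delta_equiv_trans A delta y x z :
  delta_equiv A delta x y -> delta_equiv A delta y z -> delta_equiv A delta x z.
Proof.
move=> [Ax Ay [s [sA ps ls]]] [_ Az [t [tA pt lt]]]; split=> //.
exists (s ++ t); split.
- by move=> w; rewrite mem_cat => /orP[/sA|/tA].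
- by rewrite cat_path ps ls.
- by rewrite last_cat ls.
Qed.

Lemma delta_equiv_step A delta x y :
  A x -> A y -> eucl_dist x y <= delta -> delta_equiv A delta x y.
Proof.
move=> Ax Ay xy; split=> //; exists [:: y]; split=> //=.
- by move=> z; rewrite inE => /eqP->.
- by rewrite eucl_distC xy.
Qed.

(** Spares later arguments the handling of chains: an invariant of single steps, such as lying in a
    cell or left of a gap, passes to equivalent points. *)
Lemma delta_equiv_ind A delta (P : R * R -> Prop) :
  (forall p q, A p -> A q -> eucl_dist p q <= delta -> P p -> P q) ->
  forall x y, delta_equiv A delta x y -> P x -> P y.
Proof.
move=> step x y [Ax Ay [s [sA ps <-]]]; elim: s x Ax sA ps {Ay} => //= z s IHs.
move=> x Ax sA /andP[xz pz] Px.
have Az : A z by apply: sA; rewrite inE eqxx.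
apply: (IHs z) => //; first by move=> w ws; apply: sA; rewrite inE ws orbT.
by apply: (step x) => //; rewrite eucl_distC.
Qed.

Lemma delta_equiv_sym A delta x y :
  delta_equiv A delta x y -> delta_equiv A delta y x.
Proof.
move=> xy; have [Ax _ _] := xy.
apply: (delta_equiv_ind (P := fun z => delta_equiv A delta z x) _ xy).
  move=> p q Ap Aq pq px; apply: delta_equiv_trans px.
  by apply: delta_equiv_step => //; rewrite eucl_distC.
exact: delta_equiv_refl.
Qed.

Lemma delta_equiv_le A delta delta' x y : delta <= delta' ->
  delta_equiv A delta x y -> delta_equiv A delta' x y.
Proof.
move=> dd' xy; have [Ax _ _] := xy.
apply: (delta_equiv_ind (P := fun z => delta_equiv A delta' x z) _ xy).
  move=> p q Ap Aq pq xp; apply: delta_equiv_trans xp _.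
  by apply: delta_equiv_step => //; exact: le_trans dd'.
exact: delta_equiv_refl.
Qed.

Definition classes A delta : set (set (R * R)) :=
  [set [set y | delta_equiv A delta x y] | x in A].

Lemma delta_class_eq A delta x y : delta_equiv A delta x y ->
  [set z | delta_equiv A delta x z] = [set z | delta_equiv A delta y z].
Proof.
move=> xy; apply/seteqP; split=> z /=; apply: delta_equiv_trans => //.
exact: delta_equiv_sym.
Qed.

Lemma delta_class_inj A delta x y : A y ->
  [set z | delta_equiv A delta x z] = [set z | delta_equiv A delta y z] ->
  delta_equiv A delta x y.
Proof. by move=> Ay /seteqP[_ /(_ y)]; apply; exact: delta_equiv_refl. Qed.

Lemma card_fset_setE (T : choiceType) (F : set T) :
  finite_set F -> (F #= `I_#|` fset_set F|%fset)%card.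
Proof. by move=> finF; rewrite -{1}(fset_setK finF); apply/card_eq_fsetP. Qed.

Lemma card_fset_set_ge (T : choiceType) (F : set T) N :
  finite_set F -> (`I_N #<= F)%card -> (N <= #|` fset_set F|%fset)%N.
Proof. by move=> /card_fset_setE/card_le_eqr->; rewrite card_le_II. Qed.

(** Two points of one covering set are joined by a single step, so each member of the cover accounts
    for at most one class. *)
Lemma class_number_cover A delta N (U : 'I_N -> set (R * R)) :
  (forall i p q, U i p -> U i q -> eucl_dist p q <= delta) ->
  A `<=` \bigcup_(i in [set: 'I_N]) U i ->
  finite_set (classes A delta) /\ (class_number A delta <= N)%N.
Proof.
move=> Ud AU.
pose g (i : 'I_N) := [set z | delta_equiv A delta (get (A `&` U i)) z].
have sub : classes A delta `<=` g @` [set: 'I_N].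
  move=> _ [x Ax <-]; have [i _ Uix] := AU _ Ax; exists i => //.
  apply: delta_class_eq.
  have [Ag Ug] : (A `&` U i) (get (A `&` U i)) by apply: (getI (x := x)).
  by apply: delta_equiv_step => //; exact: Ud Ug Uix.
have le : (classes A delta #<= `I_N)%card.
  apply: card_le_trans (subset_card_le sub) _.
  apply: card_le_trans (card_image_le _ _) _.
  by rewrite -(card_le_eql card_II).
have fin : finite_set (classes A delta) by apply: card_le_finite le _.
by split=> //; exact: geq_card_fset_set.
Qed.

Lemma class_number_ge A delta (I : finType) (p : I -> R * R) :
  finite_set (classes A delta) -> (forall i, A (p i)) ->
  (forall i j, delta_equiv A delta (p i) (p j) -> i = j) ->
  (#|I| <= class_number A delta)%N.
Proof.
move=> fin Ap pinj; apply: card_fset_set_ge => //.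
rewrite (card_le_eql card_II).
pose g (i : 'I_#|I|) := [set z | delta_equiv A delta (p (enum_val i)) z].
have ginj : {in [set: 'I_#|I|] &, injective g}.
  by move=> i j _ _ /(delta_class_inj (Ap _))/pinj/enum_val_inj.
rewrite -(card_le_eql (inj_card_eq ginj)).
by apply: subset_card_le => _ [i _ <-]; exists (p (enum_val i)).
Qed.

Lemma classes_le_card A delta delta' : delta <= delta' ->
  (classes A delta' #<= classes A delta)%card.
Proof.
(* [g] sends a class to the coarser class of a point chosen in it; every coarser class is reached
   this way. *)
move=> dd'; pose g (S : set (R * R)) := [set z | delta_equiv A delta' (get S) z].
apply: card_le_trans (card_image_le g _); apply: subset_card_le => _ [x Ax <-].
exists [set y | delta_equiv A delta x y]; first by exists x.
apply/esym/delta_class_eq.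
apply: (delta_equiv_le dd'); exact: (getI (x := x) (delta_equiv_refl _ Ax)).
Qed.

Lemma class_number_noninc A delta delta' : finite_set (classes A delta) ->
  delta <= delta' -> (class_number A delta' <= class_number A delta)%N.
Proof.
move=> fin dd'; have h := classes_le_card A dd'.
have fin' : finite_set (classes A delta') by exact: card_le_finite h fin.
apply: card_fset_set_ge => //.
by rewrite -(card_le_eql (card_fset_setE fin')).
Qed.

Lemma continuous_eucl_dist2 :
  continuous (fun z : (R * R) * (R * R) =>
    (z.1.1 - z.2.1) ^+ 2 + (z.1.2 - z.2.2) ^+ 2).
Proof.
move=> z.
have c11 : (fun z : (R * R) * (R * R) => z.1.1) w @[w --> z] --> z.1.1.
  exact: (cvg_comp _ _ cvg_fst cvg_fst).
have c12 : (fun z : (R * R) * (R * R) => z.1.2) w @[w --> z] --> z.1.2.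
  exact: (cvg_comp _ _ cvg_fst cvg_snd).
have c21 : (fun z : (R * R) * (R * R) => z.2.1) w @[w --> z] --> z.2.1.
  exact: (cvg_comp _ _ cvg_snd cvg_fst).
have c22 : (fun z : (R * R) * (R * R) => z.2.2) w @[w --> z] --> z.2.2.
  exact: (cvg_comp _ _ cvg_snd cvg_snd).
apply: cvgD; rewrite expr2; under eq_cvg do rewrite expr2.
  by apply: cvgM; apply: cvgB.
by apply: cvgM; apply: cvgB.
Qed.

(** Source of right-continuity: the inequivalent pairs form a compact set, where the distance
    attains a minimum, and this minimum exceeds [delta]. *)
Lemma delta_equiv_near A delta : 0 < delta -> compact A ->
  exists2 eta, delta < eta & forall x y, A x -> A y -> eucl_dist x y < eta ->
    delta_equiv A delta x y.
Proof.
move=> d0 cA.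
pose D := [set z : (R * R) * (R * R) |
  [/\ A z.1, A z.2 & ~ delta_equiv A delta z.1 z.2]].
have [D0|D0] := pselect (D !=set0); last first.
  exists (delta + 1); first by rewrite ltrDl.
  move=> x y Ax Ay _; apply: contrapT => nxy.
  by apply: D0; exists (x, y).
have hA : closed A by apply: compact_closed => //; exact: norm_hausdorff.
have half p q : ball p (delta / 2) q -> eucl_dist p q <= delta.
  move=> [/= b1 b2]; apply: (le_trans (eucl_dist_le_sum _ _)).
  by rewrite [leRHS]splitr lerD// ltW.
(* If a limit pair were equivalent, so would be a nearby pair of [D], since each end moves by one
   admissible step. *)
have cD : compact D.
  apply: (subclosed_compact _ (compact_setX cA cA)); last by move=> z [].
  move=> z clz.
  have A1 : A z.1.
    apply: hA => B nB.
    have [|w [[Aw _ _] [Bw _]]] := clz (B `*` setT).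
      by exists (B, setT) => //; split=> //; exact: filterT.
    by exists w.1.
  have A2 : A z.2.
    apply: hA => B nB.
    have [|w [[_ Aw _] [_ Bw]]] := clz (setT `*` B).
      by exists (setT, B) => //; split=> //; exact: filterT.
    by exists w.2.
  split=> // zz.
  have [|w [[Aw1 Aw2 nw] [b1 b2]]] := clz (ball z (delta / 2)).
    by apply: nbhsx_ballx; rewrite divr_gt0.
  apply: nw; apply: (delta_equiv_trans (y := z.1)).
    by apply: delta_equiv_step => //; rewrite eucl_distC; apply: half.
  by apply: delta_equiv_trans zz _; apply: delta_equiv_step => //; apply: half.
have [z zD zmin] := compact_EVT_min D0 cD
  (continuous_subspaceT continuous_eucl_dist2).
have [Az1 Az2 nz] := set_mem zD.
exists (eucl_dist z.1 z.2).
  by rewrite ltNge; apply/negP => le; apply: nz; exact: delta_equiv_step.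
move=> x y Ax Ay; apply: contraPP => nxy; apply/negP; rewrite -leNgt.
by apply: ler_wsqrtr; apply: (zmin (x, y)); apply/mem_set.
Qed.

(** A step shorter than [eta] stays inside one [delta]-class, so chains at the scales in between
    identify nothing new. *)
Lemma class_number_right A delta : 0 < delta -> compact A ->
  exists2 eta, delta < eta & forall delta', delta <= delta' < eta ->
    class_number A delta' = class_number A delta.
Proof.
move=> d0 cA; have [eta deta h] := delta_equiv_near d0 cA.
exists eta => // delta' /andP[dd' d'eta].
suff e x y : delta_equiv A delta' x y = delta_equiv A delta x y.
  by rewrite /class_number; congr (#|` fset_set _|%fset); apply: eq_imagel => x _;
     apply/seteqP; split=> y /=; rewrite e.
apply/propext; split; last exact: delta_equiv_le.
move=> xy; have [Ax _ _] := xy.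
apply: (delta_equiv_ind (P := fun z => delta_equiv A delta x z) _ xy).
  move=> p q Ap Aq pq xp; apply: delta_equiv_trans xp _.
  by apply: h => //; exact: le_lt_trans d'eta.
exact: delta_equiv_refl.
Qed.

End ClassNumber.

(** * Jumps of the class number and positions in the gap sequence *)

Section GapSequence.
Context {R : realType} (A : set (R * R)).
Hypothesis cA : compact A.
Hypothesis finA : forall delta, 0 < delta -> finite_set (classes A delta).

Lemma class_number_noninc_gt0 delta delta' : 0 < delta -> delta <= delta' ->
  (class_number A delta' <= class_number A delta)%N.
Proof. by move=> d0 dd'; apply: class_number_noninc => //; exact: finA. Qed.

Lemma class_number_left_eq delta : 0 < delta ->
  exists2 h0, 0 < h0 <= delta / 2 & forall h, 0 < h <= h0 ->
    class_number A (delta - h) = class_number_left A delta.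
Proof.
move=> d0; have d20 : 0 < delta / 2 by rewrite divr_gt0.
pose P k := `[< exists2 h, 0 < h <= delta / 2 & class_number A (delta - h) = k >].
have exP : exists k, P k.
  by exists (class_number A (delta - delta / 2)); apply/asboolP;
     exists (delta / 2); rewrite ?d20 ?lexx.
case: (ex_minnP exP) => k /asboolP[h0 /andP[h00 h0d] Nk] kmin.
have ne h : 0 < h <= h0 -> class_number A (delta - h) = k.
  move=> /andP[h_gt0 hh0]; apply/eqP; rewrite eqn_leq; apply/andP; split.
    rewrite -Nk; apply: class_number_noninc_gt0; last by rewrite lerB.
    by rewrite subr_gt0 (le_lt_trans h0d)// ltr_pdivrMr// ltr_pMr// ltr1n.
  apply: kmin; apply/asboolP; exists h => //; rewrite h_gt0/=.
  exact: le_trans h0d.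
have -> : class_number_left A delta = k.
  apply: lim_near_cst; first exact: discrete_hausdorff.
  near=> h; apply: ne; apply/andP; split; first by near: h; exact: nbhs_right_gt.
  by near: h; exact: nbhs_right_le.
by exists h0; rewrite ?h00.
Unshelve. all: by end_near.
Qed.

Lemma class_number_left_le delta' delta : 0 < delta' < delta ->
  (class_number_left A delta <= class_number A delta')%N.
Proof.
move=> /andP[d'0 d'd]; have d0 := lt_trans d'0 d'd.
have [h0 /andP[h00 _] e] := class_number_left_eq d0.
rewrite -(e (Num.min h0 (delta - delta'))); last first.
  by rewrite lt_min subr_gt0 d'd h00 ge_min lexx.
apply: class_number_noninc_gt0 => //.
by rewrite lerBrDl -lerBrDr ge_min lexx orbT.
Qed.

Lemma class_number_left_ge delta : 0 < delta ->
  (class_number A delta <= class_number_left A delta)%N.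
Proof.
move=> d0; have [h0 /andP[h00 h0d] e] := class_number_left_eq d0.
rewrite -(e h0) ?h00 ?lexx//.
apply: class_number_noninc_gt0; last by rewrite gerBl ltW.
by rewrite subr_gt0 (le_lt_trans h0d)// ltr_pdivrMr// ltr_pMr// ltr1n.
Qed.

Variables (K : set nat) (alpha : nat -> R).
Hypothesis hgap : gap_sequence A K alpha.

Lemma gap_jump_lt k : K k ->
  (class_number A (alpha k) < class_number_left A (alpha k))%N.
Proof.
by move=> Kk; apply/(gap_jump hgap (gap_gt0 hgap Kk)); exists k.
Qed.

(** The indices up to [k] with value [alpha k] fit into the jump at that value. The index before the
    first of them has a larger value, hence by induction is at most [class_number A (alpha k)]. *)
Lemma gap_index_le k : K k -> (k <= class_number_left A (alpha k))%N.
Proof.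
elim/ltn_ind: k => k IHk Kk; have k0 := gap_index_gt0 hgap Kk.
have a0 := gap_gt0 hgap Kk; have jump := gap_jump_lt Kk.
have exP : exists j, (0 < j <= k)%N && (alpha j == alpha k).
  by exists k; rewrite k0 leqnn eqxx.
case: (ex_minnP exP) => j /andP[/andP[j0 jk] /eqP ajk] jmin.
have mult : (k.+1 - j <= class_number_left A (alpha k) - class_number A (alpha k))%N.
  rewrite -card_le_II -(card_le_eqr (gap_mult hgap a0 jump)).
  have inj : {in `I_(k.+1 - j) &, injective (addn j)}.
    by move=> x y _ _; exact: addnI.
  rewrite -(card_le_eql (inj_card_eq inj)); apply: subset_card_le => _ [l /= lk <-].
  have jlk : (j + l <= k)%N by rewrite -ltnS -ltn_subRL.
  have Kjl : K (j + l)%N by apply: (gap_index_initial hgap _ Kk); rewrite addn_gt0 j0.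
  have Kj : K j by apply: (gap_index_initial hgap _ Kk); rewrite j0.
  split=> //; apply/eqP; rewrite eq_le (gap_noninc hgap Kjl Kk jlk) andbT.
  by rewrite -ajk (gap_noninc hgap Kj Kjl)// leq_addr.
have [j1|j1] := leqP j 1.
  have j1e : j = 1%N by apply/eqP; rewrite eqn_leq j1 j0.
  move: mult; rewrite j1e subSS subn0 => /leq_trans; apply; exact: leq_subr.
have jk' : (j.-1 < k)%N by rewrite prednK.
have j'0 : (0 < j.-1)%N by rewrite -ltnS prednK.
have Kj' : K j.-1.
  by apply: (gap_index_initial hgap _ Kk); rewrite j'0 ltnW.
have aj' : alpha k < alpha j.-1.
  rewrite lt_neqAle (gap_noninc hgap Kj' Kk (ltnW jk')) andbT.
  apply/negP => /eqP e; have := jmin j.-1; rewrite e j'0 (ltnW jk') eqxx.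
  by move=> /(_ isT); rewrite -ltnS prednK// ltnn.
have le1 := leq_trans (IHk _ jk' Kj') (class_number_left_le (introT andP (conj a0 aj'))).
have ke : k = (j.-1 + (k.+1 - j))%N.
  by rewrite -[in RHS](prednK j0) subSS subnKC// ltnW.
by rewrite [leqLHS]ke -(subnKC (class_number_left_ge a0)) leq_add.
Qed.

(** As the scale grows from [alpha k] to [T], the class number falls to at most 1 only through
    jumps, and each jump takes as many indices below [k] as its size. *)
Lemma class_number_le_gap_index T k : (forall delta, T <= delta ->
    (class_number A delta <= 1)%N) -> K k ->
  (class_number A (alpha k) <= k)%N.
Proof.
move=> hT Kk; have k0 := gap_index_gt0 hgap Kk.
have a0 := gap_gt0 hgap Kk.
pose g delta := #|[set l : 'I_k | (0 < l)%N && (delta < alpha l)]%SET|.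
have Kl (l : nat) : (0 < l)%N -> (l < k)%N -> K l.
  by move=> l0 lk; apply: (gap_index_initial hgap _ Kk); rewrite l0 ltnW.
(* [g] counts among the [k.-1] indices from 1 to [k.-1]; the successor stands for the single class
   left after all jumps. *)
suff main delta : alpha k <= delta -> (class_number A delta <= (g delta).+1)%N.
  apply: (leq_trans (main _ (lexx _))); rewrite -[leqRHS](prednK k0) ltnS.
  have /subset_leq_card : [set l : 'I_k | (0 < l)%N && (alpha k < alpha l)]%SET \subset
      (~: [set Ordinal k0])%SET.
    apply/fintype.subsetP => l; rewrite !inE => /andP[l0 _].
    by apply: contraTneq l0 => ->.
  by rewrite cardsC1 card_ord.
move En : (class_number A delta) => v; elim/ltn_ind: v delta En => v IHv delta En ad.
have [v1|v1] := leqP v 1; first exact: leq_trans v1 _.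
have d0 : 0 < delta by exact: lt_le_trans ad.
(* The infimum [t] of [S] is the first jump above [delta]: right-continuity places it beyond [delta]
   with the drop already made at [t], and just below [t] the value is still [v]. *)
pose S := [set u | delta < u /\ (class_number A u < v)%N].
have S0 : S !=set0.
  exists (Num.max T (delta + 1)); split; first by rewrite lt_max ltrDl ltr01 orbT.
  by apply: leq_ltn_trans v1; apply: hT; rewrite le_max lexx.
have Slb : lbound S delta by move=> u [/ltW].
have infS : has_inf S by split=> //; exists delta.
pose t := inf S.
have dt : delta < t.
  have [eta deta he] := class_number_right d0 cA.
  apply: (lt_le_trans deta); apply: lb_le_inf => // u [du uv].
  rewrite leNgt; apply/negP => ueta; move: uv; rewrite (he u) ?En ?ltnn//.
  by rewrite (ltW du).
have t0 := lt_trans d0 dt.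
have Nt : (class_number A t < v)%N.
  have [eta teta he] := class_number_right t0 cA.
  have [u Su ueta] : exists2 u, S u & u < eta.
    have [u Su] := inf_adherent (eps := eta - t) (ltac:(by rewrite subr_gt0)) infS.
    by rewrite -/t addrC subrK => h; exists u.
  rewrite -(he u); first by case: Su.
  by rewrite ueta andbT; apply: ge_inf => //; case: infS.
have Nl : class_number_left A t = v.
  have [h0 /andP[h00 h0t] e] := class_number_left_eq t0.
  pose h := Num.min h0 (t - delta).
  rewrite -(e h); last by rewrite lt_min h00 subr_gt0 dt ge_min lexx.
  have dth : delta <= t - h by rewrite lerBrDl -lerBrDr ge_min lexx orbT.
  apply/eqP; rewrite eqn_leq -{1}En class_number_noninc_gt0//= leqNgt.
  apply/negP => lt.
  have : S (t - h).
    split=> //; rewrite lt_neqAle dth andbT; apply/eqP => e'.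
    by move: lt; rewrite -e' En ltnn.
  move=> /(ge_inf (proj2 infS)); rewrite leNgt ltrBlDr ltrDl.
  by rewrite lt_min h00 subr_gt0 dt.
have jump : (class_number A t < class_number_left A t)%N by rewrite Nl.
have := gap_mult hgap t0 jump; rewrite Nl card_eq_sym => /card_eqPle[/pcard_leP[f] _].
have fP i : (i < v - class_number A t)%N -> K (f i) /\ alpha (f i) = t.
  by move=> iv; have /(_ i iv) := 'funS_f.
have fk i : (i < v - class_number A t)%N -> (0 < f i < k)%N.
  move=> /fP[Kf ft]; rewrite (gap_index_gt0 hgap Kf)/= ltnNge; apply/negP => kf.
  by have := gap_noninc hgap Kk Kf kf; rewrite ft leNgt (le_lt_trans ad dt).
pose h (i : 'I_(v - class_number A t)) : 'I_k :=
  Ordinal (proj2 (andP (fk i (ltn_ord i)))).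
have hinj : injective h.
  move=> i j /(congr1 val)/= fij; apply: val_inj.
  by have := 'inj_f; apply=> //; rewrite inE /=.
have cardh : (v - class_number A t <= #|[set l : 'I_k | (0 < l)%N && (alpha l == t)]%SET|)%N.
  rewrite -{1}(card_ord (v - _)) -cardsT -(card_imset _ hinj); apply: subset_leq_card.
  apply/fintype.subsetP => _ /imsetP[i _ ->]; rewrite inE /=.
  have /andP[-> _] := fk i (ltn_ord i).
  by have [_ ->] := fP i (ltn_ord i); rewrite eqxx.
have IH := IHv _ Nt t erefl (le_trans ad (ltW dt)).
have cardg : (#|[set l : 'I_k | (0 < l)%N && (alpha l == t)]%SET| + g t <= g delta)%N.
  rewrite /g -cardsUI (_ : _ :&: _ = finset.set0) ?cards0 ?addn0; last first.
    apply/setP => l; rewrite !inE; apply/negP => /andP[/andP[_ /eqP->]].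
    by rewrite ltxx andbF.
  apply: subset_leq_card; apply/fintype.subsetP => l; rewrite !inE.
  move=> /orP[/andP[-> /eqP->]|/andP[-> tl]]//.
  exact: lt_trans tl.
rewrite -(subnK (ltnW Nt)) -addn1; apply: leq_trans (leq_add cardh IH) _.
by rewrite addnS addn1 ltnS.
Qed.

End GapSequence.

(** * The attractor and its exponents *)

(** [I] indexes nonempty rows only. An empty row survives as [sys_strip], an open band of heights
    met by no row. *)
Record system {R : realType} {I : finType} (n : I -> nat) (b d : I -> R)
    (a c : forall i, 'I_(n i) -> R) (E : set (R * R)) : Prop := System {
  sys_n_gt0 : forall i, (0 < n i)%N;
  sys_a_gt0 : forall i j, 0 < a i j;
  sys_a_lt : forall i j, a i j < b i;
  sys_b_lt1 : forall i, b i < 1;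
  sys_c_ge0 : forall i j, 0 <= c i j;
  sys_c_le1 : forall i j, c i j + a i j <= 1;
  sys_c_step : forall i (j j' : 'I_(n i)), (j < j')%N -> c i j + a i j <= c i j';
  sys_d_ge0 : forall i, 0 <= d i;
  sys_d_le1 : forall i, d i + b i <= 1;
  sys_d_step : forall i i', i != i' -> d i + b i <= d i' \/ d i' + b i' <= d i;
  sys_strip : exists e : R * R, [/\ 0 <= e.1, e.1 < e.2, e.2 <= 1 &
    forall i, d i + b i <= e.1 \/ e.2 <= d i];
  sys_a_sum : forall i, \sum_j a i j <= 1;
  sys_b_sum : \sum_i b i <= 1;
  sys_nonempty : E !=set0;
  sys_compact : compact E;
  sys_attractor : forall p, E p <-> exists i (j : 'I_(n i)) q,
    E q /\ p = (a i j * q.1 + c i j, b i * q.2 + d i)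
}.

Lemma fin_lbound {R : realType} (T : finType) (f : T -> R) :
  (forall x, 0 < f x) -> exists2 e, 0 < e & forall x, e <= f x.
Proof.
move=> f0; exists (\big[Num.min/1]_x f x); first by apply/bigmin_gtP; split.
by move=> x; exact: bigmin_le_cond.
Qed.

Lemma big_tagged (S : Type) (idx : S) (op : Monoid.com_law idx)
    (I : finType) (J : I -> finType) (F : forall i, J i -> S) :
  \big[op/idx]_i \big[op/idx]_(j : J i) F i j =
  \big[op/idx]_(w : {i : I & J i}) F (tag w) (tagged w).
Proof.
rewrite (@sig_big_dep _ _ _ I J xpredT (fun _ => xpredT) F).
by apply: eq_bigl.
Qed.

(** Intermediate value theorem on [0, 1]: the sum is at least 1 at exponent 0 and at most 1 at
    exponent 1. *)
Lemma weight_exponent {R : realType} (J : finType) (w r : J -> R) :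
  (forall x, 0 <= w x) -> (forall x, 0 < r x) ->
  1 <= \sum_x w x -> \sum_x w x * r x <= 1 ->
  exists2 u, 0 <= u & \sum_x w x * r x `^ u = 1.
Proof.
move=> w0 r0 w1 wr1; pose f (u : R) := \sum_x w x * r x `^ u.
have cf : continuous f.
  move=> u; apply: (cvg_big (x0 := 0) (op := +%R)).
    exact: add_continuous.
  move=> x _; apply: cvgM; first exact: cvg_cst.
  rewrite /powR gt_eqF//; apply: continuous_comp; last exact: continuous_expR.
  by apply: cvgM; [exact: cvg_id|exact: cvg_cst].
have f0 : 1 <= f 0.
  by rewrite /f; under eq_bigr do rewrite powRr0 mulr1.
have f1 : f 1 <= 1.
  by rewrite /f; under eq_bigr do rewrite powRr1 ?ltW//.
have [||u u01 fu] := IVT (f := f) (a := 0) (b := 1) (v := 1) ler01.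
- exact: continuous_subspaceT.
- by rewrite ge_min f1 orbT le_max f0.
by exists u => //; move: u01; rewrite in_itv/= => /andP[].
Qed.

Section System.
Context {R : realType} {I : finType} (n : I -> nat) (b d : I -> R).
Context (a c : forall i, 'I_(n i) -> R) (E : set (R * R)).
Arguments a : clear implicits.
Arguments c : clear implicits.
Hypothesis sys : system b d a c E.
Implicit Types (p q : R * R) (i : I).

Lemma sys_b_gt0 i : 0 < b i.
Proof.
exact: lt_trans (sys_a_gt0 sys (Ordinal (sys_n_gt0 sys i))) (sys_a_lt sys _).
Qed.

Lemma sys_sub i j q : E q -> E (a i j * q.1 + c i j, b i * q.2 + d i).
Proof. by move=> Eq; apply/(sys_attractor sys); exists i, j, q. Qed.

(** At a maximum point, the value is at most [r] times itself plus [e], and [e + r <= 1] forces it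
    below 1; the minimum is treated alike. *)
Lemma contraction_unit (f : R * R -> R) : continuous f ->
  (forall p, E p -> exists q r e,
    [/\ E q, 0 < r, r < 1, 0 <= e & e + r <= 1 /\ f p = r * f q + e]) ->
  forall p, E p -> 0 <= f p <= 1.
Proof.
move=> cf fE p Ep.
have cfE := continuous_subspaceT (A := E) cf.
have [x xE xmax] := compact_EVT_max (sys_nonempty sys) (sys_compact sys) cfE.
have [y yE ymin] := compact_EVT_min (sys_nonempty sys) (sys_compact sys) cfE.
apply/andP; split.
  apply: le_trans (ymin _ (mem_set Ep)).
  have [q [r [e [Eq r0 r1 e0 [_ fy]]]]] := fE _ (set_mem yE).
  have := ymin _ (mem_set Eq); nra.
apply: (le_trans (xmax _ (mem_set Ep))).
have [q [r [e [Eq r0 r1 e0 [er fx]]]]] := fE _ (set_mem xE).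
have := xmax _ (mem_set Eq); nra.
Qed.

Lemma sys_unit1 p : E p -> 0 <= p.1 <= 1.
Proof.
apply: (contraction_unit (f := fst)); first by move=> z; exact: cvg_fst.
move=> {}p /(sys_attractor sys)[i [j [q [Eq ->]]]]; exists q, (a i j), (c i j).
split=> //; [exact: (sys_a_gt0 sys _)| |exact: (sys_c_ge0 sys _)|].
  exact: (lt_trans (sys_a_lt sys _) (sys_b_lt1 sys _)).
by split=> //; exact: (sys_c_le1 sys _).
Qed.

Lemma sys_unit2 p : E p -> 0 <= p.2 <= 1.
Proof.
apply: (contraction_unit (f := snd)); first by move=> z; exact: cvg_snd.
move=> {}p /(sys_attractor sys)[i [j [q [Eq ->]]]]; exists q, (b i), (d i).
split=> //; [exact: sys_b_gt0|exact: (sys_b_lt1 sys _)|exact: (sys_d_ge0 sys _)|].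
by split=> //; exact: (sys_d_le1 sys _).
Qed.

Lemma sys_ratio : exists r : R, [/\ 0 < r, r < 1 & forall i, b i <= r].
Proof.
have [e e0 he] : exists2 e, 0 < e & forall i, e <= 1 - b i.
  by apply: fin_lbound => i; rewrite subr_gt0 (sys_b_lt1 sys).
(* The cap 1/2 keeps the ratio positive. *)
exists (1 - Num.min e (1 / 2)); split=> //.
- by rewrite subr_gt0 gt_min; apply/orP; right; lra.
- by rewrite ltrBlDr ltrDl lt_min e0; lra.
- by move=> i; rewrite lerBrDl -lerBrDr ge_min he.
Qed.

(** [t] is the difference s - s1 in the equation that determines the dimension s. *)
Definition exponents (s1 t : R) : Prop :=
  [/\ 0 <= s1, 0 <= t, \sum_i b i `^ s1 = 1 &
      \sum_i \sum_(j < n i) b i `^ s1 * a i j `^ t = 1].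

(** [weight_exponent] applies twice: for [s1] because there is a row and the [b i] sum to at most 1,
    then for [t] because each row has a rectangle and widths summing to at most 1. *)
Lemma sys_exponents : exists s1 t, exponents s1 t.
Proof.
have [p Ep] := sys_nonempty sys.
have [i0 _] := (sys_attractor sys p).1 Ep.
have [s1 s10 es1] : exists2 s1, 0 <= s1 & \sum_i 1 * b i `^ s1 = 1.
  apply: weight_exponent => [//|x||]; first exact: sys_b_gt0.
    by rewrite (bigD1 i0)//= lerDl sumr_ge0.
  by under eq_bigr do rewrite mul1r; exact: sys_b_sum sys.
have {}es1 : \sum_i b i `^ s1 = 1.
  by rewrite -[RHS]es1; apply: eq_bigr => i _; rewrite mul1r.
pose D := {i : I & 'I_(n i)}.
have [t t0 et] : exists2 t, 0 <= t &
    \sum_(x : D) b (tag x) `^ s1 * a (tag x) (tagged x) `^ t = 1.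
  apply: weight_exponent => [x|x||]; first exact: powR_ge0.
  - exact: (sys_a_gt0 sys (tagged x)).
  - rewrite -(big_tagged _ (fun i (_ : 'I_(n i)) => b i `^ s1)) -[leLHS]es1; apply: ler_sum => i _.
    rewrite (bigD1 (Ordinal (sys_n_gt0 sys i)))//= lerDl sumr_ge0// => j _.
    exact: powR_ge0.
  - rewrite -(big_tagged _ (fun i (j : 'I_(n i)) => b i `^ s1 * a i j)) -[leRHS]es1.
    apply: ler_sum => i _; rewrite -mulr_sumr ler_piMr ?powR_ge0//.
    exact: sys_a_sum sys i.
by exists s1, t; split=> //; rewrite big_tagged.
Qed.

End System.

Lemma exp_small {R : realType} (r e : R) : 0 < r < 1 -> 0 < e ->
  exists k, r ^+ k < e.
Proof.
move=> /andP[r0 r1] e0; have := @cvg_expr R r; rewrite gtr0_norm// => /(_ r1).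
move=> /cvgrPdist_lt/(_ _ e0)[k _ /(_ k (leqnn k))].
by rewrite /= sub0r normrN gtr0_norm ?exprn_gt0// => h; exists k.
Qed.

(** * Horizontal gaps in the rows *)

Section RowGap.
Context {R : realType} {I : finType} (n : I -> nat) (b d : I -> R).
Context (a c : forall i, 'I_(n i) -> R) (E : set (R * R)).
Arguments a : clear implicits.
Arguments c : clear implicits.
Hypothesis sys : system b d a c E.
Hypothesis td : totally_disconnected E.

(* A row covering [0, 1) would put a horizontal segment in E, at the height fixed
   by the row; total disconnectedness is used only to exclude this. *)
Lemma full_row_segment i :
  (forall x, 0 <= x < 1 -> exists j, c i j <= x < c i j + a i j) ->
  forall x, 0 <= x < 1 -> E (x, d i / (1 - b i)).
Proof.
move=> full; set y := d i / _.
have b1 := sys_b_lt1 sys i; have b0 := sys_b_gt0 sys i.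
have yE : y = b i * y + d i.
  by rewrite /y; field; rewrite subr_eq0 gt_eqF.
have y01 : 0 <= y <= 1.
  rewrite divr_ge0 ?subr_ge0 ?(sys_d_ge0 sys) ?(ltW b1)//=.
  by rewrite ler_pdivrMr ?subr_gt0// mul1r lerBrDr (sys_d_le1 sys).
have [r [r0 r1 br]] := sys_ratio sys.
(* Rescaling by the rectangle whose base contains [x] gains a factor [r] in precision at each level;
   [y] is kept, being the fixed height of the row. *)
have approx k : forall x, 0 <= x < 1 ->
    exists e, [/\ E e, `|x - e.1| <= r ^+ k & `|y - e.2| <= r ^+ k].
  elim: k => [|k IHk] x x01.
    have [p Ep] := sys_nonempty sys; exists p.
    have := sys_unit1 sys Ep; have := sys_unit2 sys Ep.
    by split=> //; rewrite expr0 ler_norml; apply/andP; split; lra.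
  have [j cj] := full x x01.
  have a0 := sys_a_gt0 sys j; have ar := ltW (lt_le_trans (sys_a_lt sys j) (br i)).
  have [|e [Ee e1 e2]] := IHk ((x - c i j) / a i j).
    apply/andP; split; first by rewrite divr_ge0 ?(ltW a0)//; lra.
    by rewrite ltr_pdivrMr//; lra.
  exists (a i j * e.1 + c i j, b i * e.2 + d i); split; rewrite ?exprS/=.
  - exact: (sys_sub sys).
  - rewrite (_ : x - _ = a i j * ((x - c i j) / a i j - e.1)); last first.
      by field; rewrite gt_eqF.
    by rewrite normrM ger0_norm ?ler_pM// ltW.
  - rewrite {1}yE (_ : _ - _ = b i * (y - e.2)); last by ring.
    by rewrite normrM ger0_norm ?ler_pM// ltW.
move=> x x01.
have cE : closed E.
  by apply: compact_closed; [exact: norm_hausdorff|exact: sys_compact sys].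
apply: cE => B /nbhs_ballP[e /= e0 eB].
have [k rke] := exp_small (introT andP (conj r0 r1)) e0.
have [p [Ep p1 p2]] := approx k x x01; exists p; split=> //; apply: eB.
by split; [exact: le_lt_trans p1 _|exact: le_lt_trans p2 _].
Qed.

Lemma row_not_full i : exists2 x, 0 <= x < 1 &
  forall j, x < c i j \/ c i j + a i j <= x.
Proof.
apply: contrapT => nex.
have full x : 0 <= x < 1 -> exists j, c i j <= x < c i j + a i j.
  move=> x01; apply: contrapT => nj; apply: nex; exists x => // j.
  have [xc|cx] := ltP x (c i j); first by left.
  right; rewrite leNgt; apply/negP => xa; apply: nj.
  by exists j; rewrite cx.
have seg := full_row_segment full; set y := d i / _ in seg.
pose L := (fun x : R => (x, y)) @` `[0, 1[%classic.
have LE : L `<=` E by move=> _ [x /= x01 <-]; apply: seg; move: x01; rewrite in_itv.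
have L0 : L (0, y) by exists 0 => //=; rewrite in_itv/= lexx ltr01.
have L1 : L (1 / 2, y) by exists (1 / 2) => //=; rewrite in_itv/=; apply/andP; split; lra.
have cL : connected L.
  apply: connected_continuous_connected.
    by apply/connected_intervalP; exact: interval_is_interval.
  apply: continuous_subspaceT => x.
  exact: (cvg_pair (@cvg_id _ _) (@cvg_cst _ _ _ _ _)).
have := connected_component_max L0 LE cL L1.
by rewrite td; [move=> /= [] ; lra|exact: LE].
Qed.

(** An uncovered point opens a gap that extends to the next rectangle on its right, or to 1;
    finiteness makes the length uniform. *)
Lemma row_gaps : exists2 g, 0 < g & forall i, exists h, [/\ 0 <= h, h + g <= 1 &
  forall j, c i j + a i j <= h \/ h + g <= c i j].
Proof.
have gi i : exists g, 0 < g /\ exists h, [/\ 0 <= h, h + g <= 1 &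
    forall j, c i j + a i j <= h \/ h + g <= c i j].
  have [x /andP[x0 x1] xj] := row_not_full i.
  (* Rectangles to the left of [x] impose no bound, hence the value 1. *)
  pose f j := if x < c i j then c i j - x else 1.
  have [e e0 ef] : exists2 e, 0 < e & forall j, e <= f j.
    by apply: fin_lbound => j; rewrite /f; case: ifPn; rewrite ?subr_gt0.
  exists (Num.min e (1 - x)); split; first by rewrite lt_min e0 subr_gt0.
  exists x; split=> //; first by rewrite -lerBrDl ge_min lexx orbT.
  move=> j; have [xc|cx] := xj j; last by left.
  by right; rewrite -lerBrDl ge_min; have := ef j; rewrite /f xc => ->.
have [f fP] := choice gi.
have [g g0 gf] : exists2 g, 0 < g & forall i, g <= f i.
  by apply: fin_lbound => i; case: (fP i).
exists g => // i; have [_ [h [h0 h1 hj]]] := fP i; exists h; split=> //.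
  by apply: le_trans h1; rewrite lerD2l.
move=> j; have [?|hc] := hj j; first by left.
by right; apply: le_trans hc; rewrite lerD2l.
Qed.

End RowGap.

(** * Isolated cells and separated families *)

Section VerticalCell.
Context {R : realType} {I : finType} (n : I -> nat) (b d : I -> R).
Context (a c : forall i, 'I_(n i) -> R) (E : set (R * R)).
Arguments a : clear implicits.
Arguments c : clear implicits.
Implicit Types (B C : set R) (i : I).

Definition height y := exists x, E (x, y).

(* With at least two nonempty rows the base is (0, 1). With a single one the
   height of E may be 0 or 1, and the base is the whole line. *)
Record vertical_base B : Prop := VerticalBase {
  base_stable : forall i z, B z -> B (b i * z + d i);
  base_disjoint : forall i i' z z', B z -> B z' ->
    b i * z + d i = b i' * z' + d i' -> i = i';
  base_lift : forall i z x, B z -> E (x, b i * z + d i) ->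
    exists j x', E (x', z) /\ x = a i j * x' + c i j
}.

(** No chain in [E] with steps at most [kappa] leaves the heights [C]. Control of nearby points by
    [B], even off the projection, lets the property pass through row maps. *)
Definition isolated B kappa C := forall y y', C y -> `|y - y'| <= kappa ->
  B y' /\ (height y' -> C y').

Hypothesis sys : system b d a c E.

Lemma height_unit y : height y -> 0 <= y <= 1.
Proof. by move=> [x /(sys_unit2 sys)]. Qed.

Lemma height_attractor y : height y -> exists i z, height z /\ y = b i * z + d i.
Proof.
move=> [x /(sys_attractor sys)[i [j [q [Eq [_ ->]]]]]]; exists i, q.2; split=> //.
by exists q.1; rewrite -surjective_pairing.
Qed.

Lemma height_sub i z : height z -> height (b i * z + d i).
Proof.
move=> [x Exz]; pose j := Ordinal (sys_n_gt0 sys i).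
by exists (a i j * x + c i j); exact: (sys_sub sys j Exz).
Qed.

(** Strips of distinct rows meet at most along their boundaries, and the first height is interior to
    its strip. *)
Lemma strip_eq i i' z z' : 0 < z < 1 -> 0 <= z' <= 1 ->
  b i * z + d i = b i' * z' + d i' -> i = i' /\ z = z'.
Proof.
move=> z01 z'01 e; have bi := sys_b_gt0 sys i; have bi' := sys_b_gt0 sys i'.
have [ii'|/eqP ii'] := eqVneq i i'; last first.
  by have [h|h] := sys_d_step sys (introN eqP ii'); nra.
split=> //; apply: (mulfI (lt0r_neq0 bi)); apply: (addIr (d i)).
by rewrite e ii'.
Qed.

Lemma strip_lift i z x : 0 < z < 1 -> E (x, b i * z + d i) ->
  exists j x', E (x', z) /\ x = a i j * x' + c i j.
Proof.
move=> z01 /(sys_attractor sys)[i' [j [q [Eq [-> e]]]]].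
have [ii' zq] := strip_eq z01 (sys_unit2 sys Eq) e; subst i'.
by exists j, q.1; rewrite zq -surjective_pairing.
Qed.

(** The gap is the image of the band in [sys_strip] under the first [k] rows of an address of
    [z]. *)
Lemma height_gap_near r k z : (forall i, b i <= r) -> height z ->
  exists l u g1 g2 : R, [/\ 0 <= l <= z, z <= u <= 1, u - l <= r ^+ k,
    l <= g1 < g2 /\ g2 <= u & forall y, height y -> ~ g1 < y < g2].
Proof.
move=> br; elim: k z => [|k IHk] z hz.
  have [[e1 e2] /= [e10 e12 e21 he]] := sys_strip sys.
  have /andP[z0 z1] := height_unit hz.
  exists 0, 1, e1, e2; split; rewrite ?lexx ?ler01 ?z0 ?z1 ?e10 ?expr0 ?subr0//.
  move=> _ /height_attractor[i [y [/height_unit y01 ->]]].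
  by have := sys_b_gt0 sys i; have [h|h] := he i; nra.
have [i [z' [hz' ->]]] := height_attractor hz.
have [l [u [g1 [g2 [lz zu ul [lg gu] gap]]]]] := IHk _ hz'.
have bi := sys_b_gt0 sys i; have di := sys_d_ge0 sys i; have di1 := sys_d_le1 sys i.
exists (b i * l + d i), (b i * u + d i), (b i * g1 + d i), (b i * g2 + d i); split.
- by apply/andP; split; nra.
- by apply/andP; split; nra.
- rewrite opprD addrACA subrr addr0 -mulrBr exprS ler_pM//; first exact: ltW.
  by move: lz zu; lra.
- by split; [apply/andP; split|]; nra.
- move=> y /height_attractor[i' [y' [hy' ->]]] gy.
  have y'01 := height_unit hy'.
  (* [w] is the preimage under row [i] of a height in the gap; being interior to (0, 1), it must
     equal [y'], a height inside the previous gap. *)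
  pose w := (b i' * y' + d i' - d i) / b i.
  have ew : b i * w + d i = b i' * y' + d i'.
    by rewrite /w; field; rewrite gt_eqF.
  have w12 : g1 < w < g2 by apply/andP; split; move: gy; rewrite -ew; nra.
  have w01 : 0 < w < 1 by apply/andP; split; lra.
  have [_ wy'] := strip_eq w01 y'01 ew.
  by apply: (gap w) => //; rewrite wy'.
Qed.

(** Either the middle half of the interval is free of heights, or it contains one, and a gap within
    a quarter of the length from it still fits. *)
Lemma height_gap u v : 0 <= u -> u < v -> v <= 1 ->
  exists g1 g2 : R, [/\ u <= g1, g1 < g2, g2 <= v & forall y, height y -> ~ g1 < y < g2].
Proof.
move=> u0 uv v1.
have [[z [hz uzv]]|nz] := pselect (exists z, height z /\
    u + (v - u) / 4 < z < v - (v - u) / 4); last first.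
  exists (u + (v - u) / 4), (v - (v - u) / 4); split; try lra.
  by move=> y hy hyu; apply: nz; exists y.
have [r [r0 r1 br]] := sys_ratio sys.
have [k rk] := exp_small (introT andP (conj r0 r1))
  (ltac:(lra) : 0 < (v - u) / 4).
have [l [w [g1 [g2 [lz zw wl [lg gw] gap]]]]] := height_gap_near k br hz.
by exists g1, g2; split=> //; lra.
Qed.

Lemma vertical_cell : exists (B Q : set R) (kappa : R), [/\ vertical_base B, 0 < kappa,
  Q `<=` B, exists2 z, Q z & height z & isolated B kappa Q].
Proof.
have [p0 Ep0] := sys_nonempty sys.
have hp0 : height p0.2 by exists p0.1; rewrite -surjective_pairing.
have [[i [i' ii']]|same] := pselect (exists i i', i != i'); last first.
  have {}same i i' : i = i'.
    by apply: contrapT => ii'; apply: same; exists i, i'; apply/eqP.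
  (* With a single row no vertical separation is required and the whole line serves as base and
     cell. *)
  exists setT, setT, 1; split=> //; last by exists p0.2.
  split=> // i z x _ /(sys_attractor sys)[i' [j [q [Eq [-> e]]]]].
  have ii' := same i i'; subst i'; exists j, q.1; split=> //.
  have -> : z = q.2.
    by apply: (mulfI (lt0r_neq0 (sys_b_gt0 sys i))); apply: (addIr (d i)).
  by rewrite -surjective_pairing.
pose B := [set z : R | 0 < z < 1].
(* Apply the lower row [i] to a height in the upper row [i']: the result is positive since row [i']
   starts above 0, and below 1 since row [i] ends below row [i']. *)
have [y0 hy0 y01] : exists2 y, height y & 0 < y < 1.
  wlog le : i i' ii' / d i + b i <= d i'.
    move=> H; have [|] := sys_d_step sys ii'; first exact: H.
    by apply: H; rewrite eq_sym.
  pose y' := b i' * p0.2 + d i'.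
  have hy' : height y' by exact: height_sub.
  exists (b i * y' + d i); first exact: height_sub.
  have bi := sys_b_gt0 sys i; have bi' := sys_b_gt0 sys i'.
  have di := sys_d_ge0 sys i; have di' := sys_d_le1 sys i'.
  have /andP[p00 _] := height_unit hp0; have /andP[_ y'1] := height_unit hy'.
  have y'0 : 0 < y' by have := mulr_ge0 (ltW bi') p00; rewrite /y'; lra.
  by apply/andP; split; nra.
have /andP[y0_gt0 y0_lt1] := y01.
have [g1 [g2 [g10 g12 g2y gap]]] := height_gap (lexx 0) y0_gt0 (ltW y0_lt1).
have [h1 [h2 [yh1 h12 h21 gap']]] := height_gap (ltW y0_gt0) y0_lt1 (lexx 1).
(* The cell lies between a gap below [y0] and a gap above it; half the shorter gap is too little to
   cross either. *)
exists B, [set y | g2 <= y <= h1], (Num.min (g2 - g1) (h2 - h1) / 2).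
have k1 : Num.min (g2 - g1) (h2 - h1) <= g2 - g1 by rewrite ge_min lexx.
have k2 : Num.min (g2 - g1) (h2 - h1) <= h2 - h1 by rewrite ge_min lexx orbT.
have k0 : 0 < Num.min (g2 - g1) (h2 - h1) by rewrite lt_min !subr_gt0 g12.
split.
- split.
  + move=> i1 z /andP[z0 z1]; rewrite /B/=.
    have b1 := sys_b_gt0 sys i1; have d0 := sys_d_ge0 sys i1.
    by have d1 := sys_d_le1 sys i1; apply/andP; split; nra.
  + move=> i1 i2 z z' zB /andP[z0 z1] /strip_eq-/(_ zB); case=> //.
    by rewrite !ltW.
  + by move=> i1 z x zB; exact: strip_lift.
- by rewrite divr_gt0.
- by move=> y /= gy; rewrite /B/=; lra.
- by exists y0 => //=; lra.
- move=> y y' /= gy; rewrite ler_norml => yy'; split; first by rewrite /B/=; lra.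
  move=> hy'; have := gap _ hy'; have := gap' _ hy'.
  move=> n1 n2; apply/andP; split; rewrite leNgt; apply/negP => h.
    by apply: n2; rewrite h andbT; lra.
  by apply: n1; rewrite h /=; lra.
Qed.

End VerticalCell.

Lemma dep_choice (J : Type) (T : J -> Type) (P : forall j, T j -> Prop) :
  (forall j, exists x, P j x) -> exists f : forall j, T j, forall j, P j (f j).
Proof. by move=> h; exists (fun j => projT1 (cid (h j))) => j; case: (cid (h j)). Qed.

Lemma ord_sum_bij (J : finType) (N : J -> nat) :
  exists f : 'I_(\sum_j N j) -> {j : J & 'I_(N j)}, bijective f.
Proof.
have e : (\sum_j N j = #|{: {j : J & 'I_(N j)}}|)%N.
  rewrite -sum1_card; under eq_bigr do rewrite -[N _]card_ord -sum1_card.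
  exact: (big_tagged _ (fun j (_ : 'I_(N j)) => 1%N)).
exists (enum_val \o cast_ord e); apply: bij_comp; first exact: enum_val_bij.
by exists (cast_ord (esym e)); [exact: cast_ordK|exact: cast_ordKV].
Qed.

(** * Points of a slice separated by gaps *)

Section Families.
Context {R : realType}.
Implicit Types (X : set R) (al u v : R).

Definition sep al X u v := exists h, [/\ u <= h, h + al <= v &
  forall t, X t -> ~ h < t < h + al].

(* Recording a gap between every chosen point and the same end of [0, 1] makes
   the families of adjacent pieces of a row compatible with each other. *)
Definition family (left : bool) al X N := exists x : 'I_N -> R,
  [/\ forall k, X (x k),
      forall k, if left then sep al X (x k) 1 else sep al X 0 (x k) &
      forall k k', k != k' -> sep al X (x k) (x k') \/ sep al X (x k') (x k)].

Lemma family0 s al X : family s al X 0.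
Proof. by exists (fun=> 0); split=> -[]. Qed.

Lemma sep_le al X u v u' v' : u' <= u -> v <= v' -> sep al X u v -> sep al X u' v'.
Proof.
move=> u'u vv' [h [uh hv hX]]; exists h; split=> //; first exact: le_trans uh.
exact: le_trans hv vv'.
Qed.

Variables (N0 : nat) (a c : 'I_N0 -> R).
Hypothesis a_gt0 : forall j, 0 < a j.
Hypothesis c_ge0 : forall j, 0 <= c j.
Hypothesis c_le1 : forall j, c j + a j <= 1.
Hypothesis c_step : forall j j' : 'I_N0, (j < j')%N -> c j + a j <= c j'.

Definition row_image X := [set x' | exists j x, X x /\ x' = a j * x + c j].

(** The gap is rescaled into the interval of rectangle [j], which the other rectangles of the row
    can meet only at its ends. *)
Lemma row_image_sep X j al u v : X `<=` `[0, 1]%classic ->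
  0 <= u -> v <= 1 -> sep (al / a j) X u v ->
  sep al (row_image X) (a j * u + c j) (a j * v + c j).
Proof.
move=> X01 u0 v1 [h [uh hv hX]]; have aj := a_gt0 j.
have eh : a j * (h + al / a j) = a j * h + al by field; rewrite gt_eqF.
have hv' : a j * h + al <= a j * v by rewrite -eh ler_pM2l.
exists (a j * h + c j); split.
- by rewrite lerD2r ler_pM2l.
- by rewrite addrAC lerD2r.
- move=> _ [j' [x [Xx ->]]] ht; have /= := X01 _ Xx; rewrite in_itv/= => /andP[x0 x1].
  have aj' := a_gt0 j'.
  have [jj'|jj'|/val_inj jj'] := ltngtP j j'.
  + by have := c_step jj'; nra.
  + by have := c_step jj'; nra.
  + subst j'; apply: (hX x Xx).
    by apply/andP; split; rewrite -(ltr_pM2l aj) ?eh; lra.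
Qed.

(** Points in one rectangle keep their rescaled gaps. For points in different rectangles, the gap
    towards the common end, [y_end], of one of them lies between the two. *)
Lemma family_row s al X (N : 'I_N0 -> nat) : X `<=` `[0, 1]%classic ->
  (forall j, family s (al / a j) X (N j)) ->
  family s al (row_image X) (\sum_j N j)%N.
Proof.
move=> X01 /dep_choice[x xP].
have x01 j k : 0 <= x j k <= 1.
  by have [/(_ k)/X01 + _ _] := xP j; rewrite /= in_itv.
have [f [f' ff' f'f]] := ord_sum_bij N.
pose y (w : {j : 'I_N0 & 'I_(N j)}) := a (tag w) * x _ (tagged w) + c (tag w).
have y_cell w : c (tag w) <= y w <= c (tag w) + a (tag w).
  have /andP[x0 x1] := x01 (tag w) (tagged w); have := a_gt0 (tag w).
  by rewrite /y => ?; apply/andP; split; nra.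
have y_end w : if s then sep al (row_image X) (y w) (c (tag w) + a (tag w))
    else sep al (row_image X) (c (tag w)) (y w).
  have [_ /(_ (tagged w)) + _] := xP (tag w).
  have /andP[x0 x1] := x01 (tag w) (tagged w).
  case: (s) => h.
    by have := row_image_sep X01 x0 (lexx 1) h; rewrite mulr1 [a _ + c _]addrC.
  by have := row_image_sep X01 (lexx 0) x1 h; rewrite mulr0 add0r.
exists (y \o f); split.
- by move=> k; exists (tag (f k)), (x _ (tagged (f k))); split=> //; case: (xP (tag (f k))).
- move=> k; have /= := y_end (f k); case: (s) => /sep_le; apply=> //.
- move=> k k' kk'; have /= : f k != f k' by apply: contra kk' => /eqP/(can_inj ff')->.
  move: (f k) (f k') => w w'.
  have [lt|lt|/val_inj e] := ltngtP (tag w) (tag w').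
  + move=> _; left; have := y_end w; have := y_end w'.
    have /andP[? ?] := y_cell w; have /andP[? ?] := y_cell w'; have cs := c_step lt.
    case: (s) => h1 h2.
      by apply: sep_le h2 => //; apply: le_trans cs _.
    by apply: sep_le h1 => //; apply: le_trans cs.
  + move=> _; right; have := y_end w; have := y_end w'.
    have /andP[? ?] := y_cell w; have /andP[? ?] := y_cell w'; have cs := c_step lt.
    case: (s) => h1 h2.
      by apply: sep_le h1 => //; apply: le_trans cs _.
    by apply: sep_le h2 => //; apply: le_trans cs.
  + case: w w' e => j k1 [j' k2] /= e; subst j'; rewrite eq_Tagged /= => k12.
    have [_ _ /(_ k1 k2 k12)] := xP j.
    have /andP[? ?] := x01 j k1; have /andP[? ?] := x01 j k2.
    by case=> h; [left|right]; exact: row_image_sep.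
Qed.

(** One point suffices: the side is decided by where the first rectangle lies relative to the gap of
    the row. *)
Lemma family_gap X g h : X `<=` `[0, 1]%classic -> X !=set0 -> (0 < N0)%N ->
  0 <= h -> h + g <= 1 -> (forall j, c j + a j <= h \/ h + g <= c j) ->
  exists s, forall al, al <= g -> family s al (row_image X) 1.
Proof.
move=> X01 [x Xx] N0_gt0 h0 h1 hj; pose j := Ordinal N0_gt0.
have in01 t : X t -> 0 <= t <= 1 by move=> /X01; rewrite /= in_itv.
have x01 := in01 _ Xx; have aj := a_gt0 j.
have gap al : al <= g -> forall t, row_image X t -> ~ h < t < h + al.
  move=> alg _ [j' [t [/in01 t01 ->]]]; have := a_gt0 j'.
  by have [?|?] := hj j'; nra.
have [jh|hjg] := hj j; [exists true|exists false] => al alg;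
    exists (fun=> a j * x + c j); split=> //; try by move=> k; exists j, x.
- by move=> _; exists h; split; [nra|lra|exact: gap].
- by move=> k k'; rewrite !ord1 eqxx.
- by move=> _; exists h; split; [nra|nra|exact: gap].
- by move=> k k'; rewrite !ord1 eqxx.
Qed.

End Families.

Lemma powR_divN {R : realType} (x y u : R) : 0 < x -> 0 < y ->
  (x / y) `^ (- u) = x `^ (- u) * y `^ u.
Proof.
move=> x0 y0; rewrite /powR !gt_eqF ?divr_gt0// ln_div ?posrE// -expRD.
by congr expR; ring.
Qed.

Lemma le_powRN {R : realType} (x y u : R) : 0 <= u -> 0 < x -> x <= y ->
  y `^ (- u) <= x `^ (- u).
Proof.
move=> u0 x0 xy; have y0 := lt_le_trans x0 xy.
rewrite /powR !gt_eqF// ler_expR !mulNr lerN2 ler_wpM2l// ler_ln ?posrE//.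
Qed.

(** * Recursive construction of isolated cells and their families *)

Section Cells.
Context {R : realType} {I : finType} (n : I -> nat) (b d : I -> R).
Context (a c : forall i, 'I_(n i) -> R) (E : set (R * R)).
Arguments a : clear implicits.
Arguments c : clear implicits.
Implicit Types (C : set R) (i : I).

Definition slice C := [set x | exists2 y, C y & E (x, y)].
Definition row_map i (y : R) := b i * y + d i.

(** [cells_row] presents every cell as the image of another set under a row, so that its slice has
    the gap of that row. *)
Record cells (B : set R) (margin : R) (V : finType) (C : V -> set R) : Prop := Cells {
  cells_base : forall v, C v `<=` B;
  cells_meet : forall v, exists2 z, C v z & height E z;
  cells_disjoint : forall v v' z, C v z -> C v' z -> v = v';
  cells_isolated : forall v, isolated E B margin (C v);
  cells_row : forall v, exists i C', [/\ C' `<=` B, exists2 z, C' z & height E z &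
    C v = row_map i @` C']
}.

Hypothesis sys : system b d a c E.
Variables (s1 t : R).
Hypothesis exps : exponents b a s1 t.
Variable B : set R.
Hypothesis hB : vertical_base b d a c E B.
Variables (g : R).
Hypothesis g_gt0 : 0 < g.
Hypothesis gaps : forall i, exists h, [/\ 0 <= h, h + g <= 1 &
  forall j, c i j + a i j <= h \/ h + g <= c i j].
Variable mu : R.
Hypothesis mu_gt0 : 0 < mu.
Hypothesis mu_le : forall i j, mu <= a i j.

Lemma mu_le_b i : mu <= b i.
Proof.
have j := Ordinal (sys_n_gt0 sys i).
exact: le_trans (mu_le j) (ltW (sys_a_lt sys j)).
Qed.

Lemma slice_unit C : slice C `<=` `[0, 1]%classic.
Proof. by move=> x [y _ /(sys_unit1 sys)]; rewrite /= in_itv. Qed.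

Lemma slice_nonempty C : (exists2 z, C z & height E z) -> slice C !=set0.
Proof. by move=> [z Cz [x Exz]]; exists x, z. Qed.

(** By [base_lift], only row [i] contributes at heights coming from [B]. *)
Lemma slice_row i C : C `<=` B ->
  slice (row_map i @` C) = row_image (a i) (c i) (slice C).
Proof.
move=> CB; apply/seteqP; split=> [x [_ [z Cz <-]]|x].
  move=> /(base_lift hB (CB _ Cz))[j [x' [Ex' ->]]].
  by exists j, x'; split=> //; exists z.
move=> [j [x' [[z Cz Exz] ->]]]; exists (row_map i z); first by exists z.
exact: (sys_sub sys j Exz).
Qed.

(** Pulling back by row [i] divides distances by [b i], and [base_lift] turns heights near the image
    into heights near [C]. *)
Lemma isolated_row i margin C : C `<=` B -> isolated E B (margin / b i) C ->
  isolated E B margin (row_map i @` C).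
Proof.
move=> CB iso _ y' [z Cz <-] zy'; have bi := sys_b_gt0 sys i.
pose z' := (y' - d i) / b i.
have ey' : y' = row_map i z' by rewrite /row_map /z'; field; rewrite gt_eqF.
have zz' : `|z - z'| <= margin / b i.
  rewrite ler_pdivlMr//; apply: le_trans zy'; rewrite ey' /row_map.
  by rewrite opprD addrACA subrr addr0 -mulrBr normrM gtr0_norm// mulrC.
have [Bz' Cz'] := iso _ _ Cz zz'; split; first by rewrite ey'; exact: (base_stable hB).
rewrite ey' => -[x] /(base_lift hB Bz')[j [x' [Ex' _]]].
by exists z' => //; apply: Cz'; exists x'.
Qed.

(** The recursion stops at scales in ([mu], 1]; these factors make the bounds at most 1 there. *)
Definition cell_cst := mu `^ s1.
Definition family_cst := cell_cst * mu `^ t.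

(* Since [a i j < b i], the ratio [al / beta] grows along the recursion: starting
   from [beta <= al], the rows of a cell of height [beta] cannot be exhausted
   before the horizontal scale [al] is reached. *)
Definition many_cells (kappa beta : R) : Prop := exists (V : finType) (C : V -> set R),
  [/\ cells B (kappa * beta) C, cell_cst * beta `^ (- s1) <= #|V|%:R &
    forall al, beta <= al <= 1 -> exists N : bool -> V -> nat,
      (forall s v, family s (g * al) (slice (C v)) (N s v)) /\
      family_cst * (al `^ (- t) * beta `^ (- s1)) <= (\sum_v (N false v + N true v))%:R].

Lemma cell_cst_gt0 : 0 < cell_cst. Proof. exact: powR_gt0. Qed.
Lemma family_cst_gt0 : 0 < family_cst. Proof. by rewrite mulr_gt0 ?powR_gt0. Qed.

Lemma family_row_gap i X : X `<=` `[0, 1]%classic -> X !=set0 ->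
  exists s, forall al, al <= g -> family s al (row_image (a i) (c i) X) 1.
Proof.
move=> X01 X0; have [h [h0 h1 hj]] := gaps i.
exact: (family_gap (sys_a_gt0 sys (i := i)) X01 X0 (sys_n_gt0 sys i) h0 h1 hj).
Qed.

(** Above the scale [mu], one point per cell is enough, on the side given by the gap of its row. *)
Lemma cells_coarse margin (V : finType) (C : V -> set R) beta al :
  cells B margin C -> cell_cst * beta `^ (- s1) <= #|V|%:R -> mu < al <= 1 ->
  exists N : bool -> V -> nat,
    (forall s v, family s (g * al) (slice (C v)) (N s v)) /\
    family_cst * (al `^ (- t) * beta `^ (- s1)) <= (\sum_v (N false v + N true v))%:R.
Proof.
move=> hC cV /andP[al0 al1].
have fam v : exists s, family s (g * al) (slice (C v)) 1.
  have [i [C' [C'B C'0 ->]]] := cells_row hC v; rewrite slice_row//.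
  have [s hs] := family_row_gap i (@slice_unit C') (slice_nonempty C'0).
  by exists s; apply: hs; rewrite ler_piMr// ltW.
have [s sP] := choice fam.
exists (fun s' v => nat_of_bool (s' == s v)); split.
  move=> s' v; case: eqP => [->|_]; [exact: sP|exact: family0].
rewrite (eq_bigr (fun=> 1%N)) => [|v _]; last by case: (s v).
rewrite sum1_card; apply: le_trans cV; rewrite /family_cst -mulrA ler_wpM2l ?(ltW cell_cst_gt0)//.
rewrite mulrA ler_piMl ?powR_ge0//.
have [_ t0 _ _] := exps.
apply: le_trans (ler_wpM2l (powR_ge0 _ _) (le_powRN t0 mu_gt0 (ltW al0))) _.
by rewrite powRN mulfV// gt_eqF ?powR_gt0.
Qed.

(** A single cell suffices: the image of [Q] under any row, taken instead of [Q] itself so that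
    [cells_row] holds. *)
Lemma many_cells_coarse kappa0 Q beta : 0 < kappa0 -> Q `<=` B ->
  (exists2 z, Q z & height E z) -> isolated E B kappa0 Q -> mu < beta <= 1 ->
  many_cells (kappa0 * mu) beta.
Proof.
move=> k0 QB Q0 Qiso /andP[bbeta beta1]; have beta0 := lt_trans mu_gt0 bbeta.
have [s10 _ _ _] := exps.
have [p Ep] := sys_nonempty sys; have [i _] := (sys_attractor sys p).1 Ep.
have hC : cells B (kappa0 * mu * beta) (fun _ : unit => row_map i @` Q).
  split.
  - by move=> _ _ [z Qz <-]; apply: (base_stable hB); exact: QB.
  - move=> _; have [z Qz hz] := Q0; exists (row_map i z); first by exists z.
    exact: (height_sub sys).
  - by move=> [] [].
  - move=> _; apply: isolated_row => // y y' Qy yy'; apply: (Qiso y y' Qy).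
    apply: (le_trans yy'); rewrite ler_pdivrMr ?(sys_b_gt0 sys)// -mulrA.
    rewrite ler_pM2l//; by apply: le_trans (mu_le_b i); rewrite ler_piMr// ltW.
  - by move=> _; exists i, Q.
have cV : cell_cst * beta `^ (- s1) <= #|{: unit}|%:R.
  rewrite card_unit -(@mulfV _ (mu `^ s1)) ?gt_eqF ?powR_gt0// -powRN.
  by rewrite ler_wpM2l ?powR_ge0// le_powRN// ltW.
exists unit, (fun=> row_map i @` Q); split=> // al /andP[ab al1].
apply: cells_coarse hC cV _; rewrite al1 andbT.
exact: lt_le_trans ab.
Qed.

(** The new cells are the row images of those at height [beta / b i]; the equations of [exponents]
    say exactly that the lower bounds add up. *)
Lemma many_cells_step kappa beta : 0 < beta ->
  beta <= mu -> (forall i, many_cells kappa (beta / b i)) -> many_cells kappa beta.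
Proof.
move=> beta0 betab /dep_choice[V /dep_choice[C VC]].
have [_ _ es1 et] := exps.
have b0 i := sys_b_gt0 sys i.
pose W : finType := {i : I & V i}.
pose D (w : W) := row_map (tag w) @` C _ (tagged w).
have hC i : cells B (kappa * (beta / b i)) (C i) by case: (VC i).
have hD : cells B (kappa * beta) D.
  split.
  - move=> w _ [z Cz <-]; apply: (base_stable hB).
    exact: (cells_base (hC _) Cz).
  - move=> w; have [z Cz hz] := cells_meet (hC _) (tagged w).
    by exists (row_map (tag w) z); [exists z|exact: (height_sub sys)].
  - move=> [i v] [i' v'] _ [z /= Cz <-] [z' /= Cz' /esym e].
    have ii' := base_disjoint hB (cells_base (hC _) Cz) (cells_base (hC _) Cz') e.
    subst i'; congr existT; apply: (cells_disjoint (hC i) Cz).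
    suff -> : z = z' by [].
    by apply: (mulfI (lt0r_neq0 (b0 i))); apply: (addIr (d i)).
  - move=> w; apply: isolated_row; first exact: (cells_base (hC _)).
    by rewrite -mulrA; exact: (cells_isolated (hC _)).
  - move=> w; exists (tag w), (C _ (tagged w)); split=> //.
      exact: (cells_base (hC _)).
    exact: (cells_meet (hC _)).
have cV : cell_cst * beta `^ (- s1) <= #|W|%:R.
  rewrite (_ : cell_cst * _ = \sum_i cell_cst * beta `^ (- s1) * b i `^ s1); last first.
    by rewrite -mulr_sumr es1 mulr1.
  rewrite -sum1_card -(big_tagged _ (fun i (_ : V i) => 1%N)) natr_sum.
  apply: ler_sum => i _; have [_ + _] := VC i.
  by rewrite sum1_card powR_divN// mulrA.
exists W, D; split=> // al /andP[ab al1].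
have [al_am|am_al] := ltP mu al; first by apply: cells_coarse hD cV _; rewrite al_am.
have al0 := lt_le_trans beta0 ab.
have ex i (j : 'I_(n i)) : exists N : bool -> V i -> nat,
    (forall s v, family s (g * (al / a i j)) (slice (C i v)) (N s v)) /\
    family_cst * ((al / a i j) `^ (- t) * (beta / b i) `^ (- s1)) <=
      (\sum_v (N false v + N true v))%:R.
  have [_ _] := VC i; apply; have aij := sys_a_gt0 sys j.
  apply/andP; split; last by rewrite ler_pdivrMr// mul1r (le_trans am_al).
  rewrite ler_pdivlMr//; apply: le_trans ab; rewrite mulrAC -mulrA.
  by rewrite ler_piMr ?(ltW beta0)// ler_pdivrMr// mul1r ltW// (sys_a_lt sys).
have {ex}[N NP] := dep_choice (fun i => dep_choice (ex i)).
(* The rectangles of row [i] contribute families of the same slice at the scales [al / a i j],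
   merged by [family_row]. *)
exists (fun s w => \sum_j N _ j s (tagged w))%N; split.
  move=> s w; rewrite /D slice_row; last exact: (cells_base (hC _)).
  apply: family_row.
  - exact: (sys_a_gt0 sys).
  - exact: (sys_c_ge0 sys).
  - exact: (sys_c_le1 sys).
  - exact: (sys_c_step sys).
  - exact: slice_unit.
  - by move=> j; rewrite -mulrA; case: (NP _ j).
rewrite -(big_tagged _ (fun i v => \sum_j N i j false v + \sum_j N i j true v)%N).
rewrite (_ : family_cst * _ = \sum_i \sum_(j < n i)
    family_cst * (al `^ (- t) * beta `^ (- s1)) * (b i `^ s1 * a i j `^ t)); last first.
  by under eq_bigr do rewrite -mulr_sumr; rewrite -mulr_sumr et mulr1.
rewrite natr_sum; apply: ler_sum => i _.
under eq_bigr do rewrite -big_split/=.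
rewrite exchange_big natr_sum; apply: ler_sum => j _.
have [_] := NP i j; apply: le_trans; rewrite !powR_divN ?(sys_a_gt0 sys)//.
by rewrite le_eqVlt; apply/orP; left; apply/eqP; ring.
Qed.

Lemma many_cells_all kappa0 Q : 0 < kappa0 -> Q `<=` B ->
  (exists2 z, Q z & height E z) -> isolated E B kappa0 Q ->
  forall beta, 0 < beta <= 1 -> many_cells (kappa0 * mu) beta.
Proof.
move=> k0 QB Q0 Qiso beta /andP[beta0 beta1].
have [r [r0 r1 br]] := sys_ratio sys.
have [k rk] := exp_small (introT andP (conj r0 r1)) beta0.
elim: k beta beta0 beta1 rk => [|k IHk] beta beta0 beta1.
  by rewrite expr0 ltNge beta1.
move=> rk; have [bmb|bbm] := ltP mu beta.
  by apply: (many_cells_coarse k0 QB Q0 Qiso); rewrite bmb.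
apply: many_cells_step => // i; have bi := sys_b_gt0 sys i; apply: IHk.
- by rewrite divr_gt0.
- by rewrite ler_pdivrMr// mul1r (le_trans bbm (mu_le_b i)).
- rewrite ltr_pdivlMr//; apply: le_lt_trans rk; rewrite exprSr.
  by rewrite ler_wpM2l ?br// exprn_ge0// ltW.
Qed.

End Cells.

(** * Two-sided bounds *)

Section Bounds.
Context {R : realType} {I : finType} (n : I -> nat) (b d : I -> R).
Context (a c : forall i, 'I_(n i) -> R) (E : set (R * R)).
Arguments a : clear implicits.
Arguments c : clear implicits.
Hypothesis sys : system b d a c E.
Variables (s1 t : R).
Hypothesis exps : exponents b a s1 t.
Variable mu : R.
Hypothesis mu_gt0 : 0 < mu.
Hypothesis mu_le : forall i j, mu <= a i j.

(** One interval is enough from scale 1 on; below, pull back by each row. Dividing a scale below 1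
    by [b i] stays under [mu^-1], whence that range. *)
Lemma vertical_cover beta : 0 < beta <= mu^-1 ->
  exists (N : nat) (u : 'I_N -> R),
    (forall y, height E y -> exists k, `|y - u k| <= beta) /\
    N%:R <= mu `^ (- s1) * beta `^ (- s1).
Proof.
have [s10 _ es1 _] := exps.
have [r [r0 r1 br]] := sys_ratio sys.
move=> /andP[beta0 betam]; have [k rk] := exp_small (introT andP (conj r0 r1)) beta0.
have coarse be : 0 < be <= mu^-1 -> 1 <= be -> exists (N : nat) (u : 'I_N -> R),
    (forall y, height E y -> exists k, `|y - u k| <= be) /\
    N%:R <= mu `^ (- s1) * be `^ (- s1).
  move=> /andP[be0 bem] be1; exists 1%N, (fun=> 0); split.
    move=> y /(height_unit sys)/andP[y0 y1]; exists ord0.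
    by rewrite subr0 ger0_norm// (le_trans y1).
  rewrite -(powRM _ (ltW mu_gt0) (ltW be0)) (_ : 1%:R = 1 `^ (- s1)); last by rewrite powR1.
  rewrite le_powRN ?mulr_gt0//.
  by rewrite -ler_pdivlMl// mulr1.
elim: k beta beta0 betam rk => [|k IHk] beta beta0 betam.
  by rewrite expr0 => /ltW; apply: coarse; rewrite beta0.
move=> rk; have [b1|b1] := leP 1 beta; first by apply: coarse => //; rewrite beta0.
have IH i : exists N (u : 'I_N -> R),
    (forall y, height E y -> exists k, `|y - u k| <= beta / b i) /\
    N%:R <= mu `^ (- s1) * (beta / b i) `^ (- s1).
  have bi := sys_b_gt0 sys i; apply: IHk.
  - by rewrite divr_gt0.
  - rewrite ler_pdivrMr// ler_pdivlMl//.
    apply: le_trans (mu_le_b sys mu_le i).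
    by rewrite ler_piMr ?ltW.
  - rewrite ltr_pdivlMr//; apply: le_lt_trans rk; rewrite exprSr.
    by rewrite ler_wpM2l ?br// exprn_ge0// ltW.
have [N /dep_choice[u uP]] := dep_choice IH.
have [f [f' ff' f'f]] := ord_sum_bij N.
exists (\sum_i N i)%N, (fun k => b (tag (f k)) * u _ (tagged (f k)) + d (tag (f k))).
split=> [y /(height_attractor sys)[i [z [hz ->]]]|].
  have [/(_ z hz)[k' zk] _] := uP i.
  exists (f' (Tagged (fun i => 'I_(N i)) k')); rewrite f'f/=.
  rewrite opprD addrACA subrr addr0 -mulrBr normrM gtr0_norm ?(sys_b_gt0 sys)//.
  by rewrite mulrC -ler_pdivlMr ?(sys_b_gt0 sys).
rewrite (_ : mu `^ (- s1) * _ =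
    \sum_i mu `^ (- s1) * beta `^ (- s1) * b i `^ s1); last first.
  by rewrite -mulr_sumr es1 mulr1.
rewrite natr_sum; apply: ler_sum => i _; have [_] := uP i.
by rewrite powR_divN ?(sys_b_gt0 sys)// mulrA.
Qed.

(** Pull back by the maps until the width reaches 1, when only heights matter and [vertical_cover]
    applies. The order [beta <= al] survives because [a i j < b i]. *)
Lemma box_cover al beta : 0 < beta -> beta <= al -> al <= mu^-1 ->
  exists (N : nat) (u : 'I_N -> R * R),
    (forall p, E p -> exists k, `|p.1 - (u k).1| <= al /\ `|p.2 - (u k).2| <= beta) /\
    N%:R <= mu `^ (- s1) * mu `^ (- t) * (al `^ (- t) * beta `^ (- s1)).
Proof.
have [s10 t0 _ et] := exps.
have [r [r0 r1 br]] := sys_ratio sys.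
move=> beta0 ba alm; have al0 := lt_le_trans beta0 ba.
have coarse al' be : 0 < be -> be <= al' -> al' <= mu^-1 -> 1 <= al' ->
    exists (N : nat) (u : 'I_N -> R * R),
    (forall p, E p -> exists k, `|p.1 - (u k).1| <= al' /\ `|p.2 - (u k).2| <= be) /\
    N%:R <= mu `^ (- s1) * mu `^ (- t) * (al' `^ (- t) * be `^ (- s1)).
  move=> be0 be_al alm' al1; have al'0 := lt_le_trans be0 be_al.
  have [|N [u [uE uN]]] := @vertical_cover be; first by rewrite be0 (le_trans be_al).
  exists N, (fun k => (0, u k)); split.
    move=> p Ep; have [|k pk] := uE p.2; first by exists p.1; rewrite -surjective_pairing.
    exists k; split=> //=; have /andP[p0 p1] := sys_unit1 sys Ep.
    by rewrite subr0 ger0_norm// (le_trans p1).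
  apply: (le_trans uN); rewrite [al' `^ _ * _]mulrC mulrACA.
  rewrite ler_peMr ?mulr_ge0 ?powR_ge0// -(powRM _ (ltW mu_gt0) (ltW al'0)).
  rewrite -[leLHS](_ : 1 `^ (- t) = 1); last by rewrite powR1.
  rewrite le_powRN ?mulr_gt0//.
  by rewrite -ler_pdivlMl// mulr1.
have [k rk] := exp_small (introT andP (conj r0 r1)) al0.
elim: k al beta beta0 ba alm al0 rk => [|k IHk] al beta beta0 ba alm al0.
  by rewrite expr0 => /ltW; exact: coarse.
move=> rk; have [al1|al1] := leP 1 al; first exact: coarse.
pose D : finType := {i : I & 'I_(n i)}.
have IH (w : D) : exists N (u : 'I_N -> R * R),
    (forall p, E p -> exists k, `|p.1 - (u k).1| <= al / a _ (tagged w) /\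
      `|p.2 - (u k).2| <= beta / b (tag w)) /\
    N%:R <= mu `^ (- s1) * mu `^ (- t) *
      ((al / a _ (tagged w)) `^ (- t) * (beta / b (tag w)) `^ (- s1)).
  have bi := sys_b_gt0 sys (tag w); have aj := sys_a_gt0 sys (tagged w).
  have ab := ltW (sys_a_lt sys (tagged w)); apply: IHk.
  - by rewrite divr_gt0.
  - by rewrite ler_pM ?(ltW beta0) ?invr_ge0 ?(ltW bi)// lef_pV2 ?posrE.
  - rewrite ler_pdivrMr// ler_pdivlMl//; apply: le_trans (mu_le (tagged w)).
    by rewrite ler_piMr ?ltW.
  - by rewrite divr_gt0.
  - rewrite ltr_pdivlMr//; apply: le_lt_trans rk; rewrite exprSr.
    by rewrite ler_wpM2l ?(le_trans ab)// exprn_ge0// ltW.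
have [N /dep_choice[u uP]] := dep_choice IH.
have [f [f' ff' f'f]] := ord_sum_bij N.
exists (\sum_w N w)%N, (fun k => let w := tag (f k) in
  (a _ (tagged w) * (u w (tagged (f k))).1 + c _ (tagged w),
   b (tag w) * (u w (tagged (f k))).2 + d (tag w))).
split=> [p /(sys_attractor sys)[i [j [q [Eq ->]]]]|].
  pose w : D := Tagged (fun i => 'I_(n i)) j.
  have [/(_ q Eq)[k' [q1 q2]] _] := uP w.
  exists (f' (Tagged (fun w => 'I_(N w)) k')); rewrite f'f/=.
  split; rewrite opprD addrACA subrr addr0 -mulrBr normrM gtr0_norm.
  - by rewrite mulrC -ler_pdivlMr ?(sys_a_gt0 sys).
  - exact: (sys_a_gt0 sys).
  - by rewrite mulrC -ler_pdivlMr ?(sys_b_gt0 sys).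
  - exact: (sys_b_gt0 sys).
rewrite big_tagged in et; set K := mu `^ (- s1) * _.
rewrite (_ : K * _ = \sum_(w : D) K * (al `^ (- t) * beta `^ (- s1)) *
    (b (tag w) `^ s1 * a _ (tagged w) `^ t)); last first.
  by rewrite -mulr_sumr et mulr1.
rewrite natr_sum; apply: ler_sum => w _; have [_ h] := uP w; apply: (le_trans h).
rewrite !powR_divN ?(sys_a_gt0 sys) ?(sys_b_gt0 sys)// /K.
by rewrite le_eqVlt; apply/orP; left; apply/eqP; ring.
Qed.

Lemma diameter_cover : exists2 K, 0 < K & forall delta, 0 < delta <= 2 ->
  exists (N : nat) (U : 'I_N -> set (R * R)),
    [/\ forall i p q, U i p -> U i q -> eucl_dist p q <= delta,
        E `<=` \bigcup_(i in [set: 'I_N]) U i &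
        N%:R <= K * delta `^ (- (s1 + t))].
Proof.
have mu1 : 1 <= mu^-1.
  have [p Ep] := sys_nonempty sys; have [i [j _]] := (sys_attractor sys p).1 Ep.
  rewrite -[leLHS]invr1 lef_pV2 ?posrE//; apply: le_trans (mu_le j) _.
  exact: ltW (lt_trans (sys_a_lt sys j) (sys_b_lt1 sys i)).
exists (mu `^ (- s1) * mu `^ (- t) * 4 `^ (s1 + t)).
  by rewrite !mulr_gt0 ?powR_gt0.
(* Boxes with half-sides [delta / 4] have sides [delta / 2], so their diameter is at most
   [delta]. *)
move=> delta /andP[d0 d2]; have d40 : 0 < delta / 4 by rewrite divr_gt0.
have [|N [u [uE uN]]] := box_cover d40 (lexx _).
  by apply: le_trans mu1; lra.
exists N, (fun k => [set p | `|p.1 - (u k).1| <= delta / 4 /\ `|p.2 - (u k).2| <= delta / 4]).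
split.
- move=> k p q [p1 p2] [q1 q2]; apply: (le_trans (eucl_dist_le_sum _ _)).
  have := ler_distD (u k).1 p.1 q.1; have := ler_distD (u k).2 p.2 q.2.
  by rewrite (distrC (u k).1) (distrC (u k).2); lra.
- by move=> p /uE[k pk]; exists k.
- apply: (le_trans uN); rewrite -[leRHS]mulrA ler_wpM2l ?mulr_ge0 ?powR_ge0//.
  rewrite [leLHS]mulrC -powRD; last by rewrite (gt_eqF d40) implybT.
  by rewrite -opprD powR_divN// mulrC.
Qed.

Lemma class_number_lower (finE : forall delta, 0 < delta -> finite_set (classes E delta))
  (td : totally_disconnected E) :
  exists2 K, 0 < K & forall delta, 0 < delta ->
    K * delta `^ (- (s1 + t)) <= (class_number E delta)%:R.
Proof.
have [s10 t0 _ _] := exps.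
have [g g0 gaps] := row_gaps sys td.
have [B [Q [k0 [hB k0_gt0 QB Q0 Qiso]]]] := vertical_cell sys.
pose kappa := k0 * mu; have kappa0 : 0 < kappa by rewrite mulr_gt0.
have mc := many_cells_all sys exps hB g0 gaps mu_gt0 mu_le k0_gt0 QB Q0 Qiso.
(* Steps of length [eta * beta] neither leave a cell, as [eta <= kappa], nor cross a gap of length
   [g * beta], as [eta < g]. *)
pose eta := Num.min kappa (g / 2).
have eta0 : 0 < eta by rewrite lt_min kappa0 divr_gt0.
have eta_k : eta <= kappa by rewrite ge_min lexx.
have eta_g : eta < g.
  by apply: (@le_lt_trans _ _ (g / 2)); [rewrite ge_min lexx orbT|lra].
have few beta : 0 < beta <= 1 -> family_cst s1 t mu * beta `^ (- (s1 + t)) <=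
    2 * (class_number E (eta * beta))%:R.
  move=> /andP[beta0 beta1].
  have [|V [C [hC _ /(_ beta)[]]]] := mc beta; first by rewrite beta0.
    by rewrite lexx.
  move=> N [fam cN].
  (* Each side alone yields pairwise inequivalent points, whence the factor 2 for the two sides
     together. *)
  have side s : (\sum_v N s v <= class_number E (eta * beta))%N.
    have [x xP] := dep_choice (fam s).
    have ex (w : {v : V & 'I_(N s v)}) : exists p, [/\ E p, C (tag w) p.2 & p.1 = x _ (tagged w)].
      have [/(_ (tagged w))[y Cy Exy] _ _] := xP (tag w).
      by exists (x _ (tagged w), y).
    have [p pP] := choice ex.
    have -> : (\sum_v N s v = #|{: {v : V & 'I_(N s v)}}|)%N.
      by have [f /bij_eq_card] := ord_sum_bij (N s); rewrite card_ord.
    apply: (class_number_ge (p := p)); first by apply: finE; rewrite mulr_gt0.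
      by move=> w; case: (pP w).
    have stay v y z : C v y.2 -> delta_equiv E (eta * beta) y z -> C v z.2.
      move=> Cy yz; apply: (delta_equiv_ind (P := fun z => C v z.2) _ yz) => //.
      move=> q q' Eq Eq' qq' Cq.
      have [|_] := cells_isolated hC Cq (y' := q'.2).
        apply: (le_trans (eucl_dist_ge2 _ _)); apply: (le_trans qq').
        by rewrite ler_pM2r.
      by apply; exists q'.1; rewrite -surjective_pairing.
    have nosep v y z : C v y.2 -> delta_equiv E (eta * beta) y z ->
        ~ sep (g * beta) (slice E (C v)) y.1 z.1.
      move=> Cy yz [h [yh hz gap]].
      (* Invariant along the chain: the point stays in the cell and to the left of the gap. *)
      suff [_ zh] : C v z.2 /\ z.1 <= h.
        by have := mulr_gt0 g0 beta0; lra.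
      apply: (delta_equiv_ind (P := fun z => C v z.2 /\ z.1 <= h) _ yz) => //.
      move=> q q' Eq Eq' qq' [Cq qh].
      have Cq' : C v q'.2 by apply: (stay _ q) => //; exact: delta_equiv_step.
      split=> //; rewrite leNgt; apply/negP => hq'; apply: (gap q'.1).
        by exists q'.2 => //; rewrite -surjective_pairing.
      rewrite hq'/=; have := le_trans (eucl_dist_ge1 _ _) qq'.
      have : eta * beta < g * beta by rewrite ltr_pM2r.
      by rewrite ler_norml; lra.
    move=> w w' ww'; have [_ Cw xw] := pP w; have [_ Cw' xw'] := pP w'.
    have e := cells_disjoint hC (stay _ _ _ Cw ww') Cw'.
    have {}stay := stay _ _ _ Cw ww'.
    have n1 := nosep _ _ _ Cw ww'.
    have n2 := nosep _ _ _ Cw' (delta_equiv_sym ww').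
    move: xw xw' n1 n2; clear -e xP; case: w w' e => v k [v' k'] /= e; subst v'.
    move=> -> -> n1 n2; congr existT; apply/eqP; apply: contrapT => /negP kk'.
    by have [_ _ /(_ _ _ kk')[]] := xP v.
  rewrite opprD [- s1 - t]addrC powRD; last by rewrite (gt_eqF beta0) implybT.
  apply: (le_trans cN).
  by rewrite big_split/= -natrM ler_nat mul2n -addnn leq_add.
have [p0 Ep0] := sys_nonempty sys.
have N1 delta : 0 < delta -> 1 <= (class_number E delta)%:R :> R.
  move=> d0; rewrite ler1n -(card_unit); apply: (class_number_ge (p := fun=> p0)) => //.
    exact: finE.
  by move=> [] [].
(* The 1 serves the scales above [eta], where the claimed bound is at most 1 and there is at least
   one class. *)
pose K := Num.min (family_cst s1 t mu / 2) 1; exists (K * eta `^ (s1 + t)).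
  by rewrite mulr_gt0 ?powR_gt0// lt_min ltr01 divr_gt0 ?family_cst_gt0.
move=> delta d0; rewrite -mulrA [eta `^ _ * _]mulrC -powR_divN//.
have [de|ed] := leP delta eta.
  have := few (delta / eta); rewrite divr_gt0// ler_pdivrMr// mul1r de => /(_ isT).
  rewrite mulrCA mulfV ?gt_eqF// mulr1 => h.
  have Kc : K <= family_cst s1 t mu / 2 by rewrite ge_min lexx.
  have := ler_wpM2r (powR_ge0 (delta / eta) (- (s1 + t))) Kc.
  by lra.
apply: le_trans (N1 _ d0); rewrite -[leRHS]mulr1.
have K0 : 0 <= K by rewrite le_min ler01 divr_ge0 ?ltW ?family_cst_gt0.
rewrite ler_pM ?powR_ge0//; first by rewrite ge_min lexx orbT.
rewrite -[leRHS](_ : 1 `^ (- (s1 + t)) = 1); last by rewrite powR1.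
rewrite le_powRN ?addr_ge0//.
by rewrite ler_pdivlMr// mul1r ltW.
Qed.

End Bounds.

(** * From power bounds to the dimension and to the gaps *)

Section BoxDimension.
Context {R : realType}.
Implicit Types (A : set (R * R)) (delta : R).

Lemma cover_number_le A delta N (U : 'I_N -> set (R * R)) :
  (forall i p q, U i p -> U i q -> eucl_dist p q <= delta) ->
  A `<=` \bigcup_(i in [set: 'I_N]) U i ->
  (class_number A delta)%:R <= cover_number A delta <= N%:R.
Proof.
move=> Ud AU; rewrite /cover_number; set S := (X in inf X).
have SN : S N%:R by exists N => //; exists U.
have Slb : lbound S (class_number A delta)%:R.
  move=> _ [M [V [Vd AV]] <-]; rewrite ler_nat.
  by have [] := class_number_cover Vd AV.
apply/andP; split; first by apply: lb_le_inf => //; exists N%:R.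
by apply: ge_inf SN; exists (class_number A delta)%:R.
Qed.

Lemma box_dim_eq A (s K1 K2 : R) : 0 < K1 -> 0 < K2 ->
  (forall delta, 0 < delta <= 1 ->
    K1 * delta `^ (- s) <= cover_number A delta <= K2 * delta `^ (- s)) ->
  box_dim A = s.
Proof.
move=> K10 K20 bnd; apply: cvg_lim; first exact: norm_hausdorff.
apply/cvgrPdist_le => e e0.
(* [M] bounds the error in [ln (cover_number A delta)]; dividing by [- ln delta] makes it at most
   [e] once [delta] is below [expR (- (M / e))]. *)
pose M := `|ln K1| + `|ln K2|; have M0 : 0 <= M by rewrite addr_ge0.
near=> delta.
have d0 : 0 < delta by near: delta; exact: nbhs_right_gt.
have d1 : delta < 1 by near: delta; exact: nbhs_right_lt.
have dM : delta < expR (- (M / e)).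
  by near: delta; apply: nbhs_right_lt; exact: expR_gt0.
have L0 : 0 < - ln delta by rewrite oppr_gt0 ln_lt0// d0.
have LM : M / e <= - ln delta.
  by rewrite lerNr -[leRHS](expRK) ler_ln ?posrE ?expR_gt0// ltW.
have /andP[c1 c2] := bnd delta (introT andP (conj d0 (ltW d1))).
have ds := powR_gt0 (- s) d0.
have c0 : 0 < cover_number A delta by apply: lt_le_trans c1; rewrite mulr_gt0.
have l1 : ln K1 - s * ln delta <= ln (cover_number A delta).
  rewrite -mulNr -ln_powR -lnM ?posrE// ler_ln ?posrE// mulr_gt0//.
have l2 : ln (cover_number A delta) <= ln K2 - s * ln delta.
  rewrite -mulNr -ln_powR -lnM ?posrE// ler_ln ?posrE// mulr_gt0//.
rewrite (_ : s - _ =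
    (s * - ln delta - ln (cover_number A delta)) / - ln delta); last first.
  by rewrite mulrBl mulfK// gt_eqF.
rewrite normrM normfV (gtr0_norm L0) ler_pdivrMr//.
rewrite ler_pdivrMr// mulrC in LM; apply: le_trans LM.
have := ler_norm (ln K1); have := ler_norm (ln K2).
have := ler_norm (- ln K1); have := ler_norm (- ln K2); rewrite !normrN /M.
by move=> *; rewrite ler_norml; apply/andP; split; lra.
Unshelve. all: by end_near.
Qed.

End BoxDimension.

Lemma gap_estimate {R : realType} (s K1 K2 : R) (K : set nat) (alpha : nat -> R) :
  0 <= s -> 0 < K1 -> 0 < K2 ->
  (forall k, K k -> [/\ (0 < k)%N, 0 < alpha k <= 2,
     K1 * alpha k `^ (- s) <= k%:R & k%:R <= K2 * alpha k `^ (- s)]) ->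
  exists2 C : R, 1 < C & forall k, K k ->
    C^-1 * k%:R `^ (- s^-1) <= alpha k /\ alpha k <= C * k%:R `^ (- s^-1).
Proof.
move=> s0 K10 K20 hK; have [sz|sn0] := eqVneq s 0.
  (* At [s = 0] the inverse is 0 by convention, so both bounds are constants; [k <= K2] leaves
     finitely many indices. *)
  have [M hM] : exists M : nat, forall k, K k -> (k < M)%N.
    exists (Num.bound K2) => k /hK[_ _ _]; rewrite sz oppr0 powRr0 mulr1 => kK.
    by rewrite -(ltr_nat R) (le_lt_trans kK)// archi_boundP// ltW.
  pose f (l : 'I_M) := if `[< K l >] then alpha l else 1.
  have [e e0 ef] : exists2 e, 0 < e & forall l, e <= f l.
    apply: fin_lbound => l; rewrite /f; case: asboolP => // /hK[_ /andP[]]//.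
  have e'0 : 0 < e^-1 by rewrite invr_gt0.
  exists (2 + e^-1); first by lra.
  move=> k Kk; rewrite sz invr0 oppr0 powRr0 !mulr1.
  have [_ /andP[a0 a2] _ _] := hK k Kk.
  split; last by lra.
  have := ef (Ordinal (hM k Kk)); rewrite /f asboolT// => /(le_trans _); apply.
  by rewrite -[leRHS]invrK lef_pV2 ?posrE//; lra.
have s_gt0 : 0 < s by rewrite lt_neqAle eq_sym sn0.
(* Raising both inequalities to the power [- s^-1] solves them for [alpha k], with these two
   factors. *)
have A0 := powR_gt0 (- s^-1) K10; have B0 := powR_gt0 (- s^-1) K20.
set A := K1 `^ _ in A0; set B := K2 `^ _ in B0.
have B'0 : 0 < B^-1 by rewrite invr_gt0.
exists (1 + A + B^-1); first by lra.
move=> k Kk; have [k0 /andP[a0 a2] h1 h2] := hK k Kk.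
have kr0 : 0 < k%:R :> R by rewrite ltr0n.
have s'0 : 0 <= s^-1 by rewrite invr_ge0.
have as0 := powR_gt0 (- s) a0.
have inva : (alpha k `^ (- s)) `^ (- s^-1) = alpha k.
  by rewrite -powRrM mulrNN mulfV// powRr1// ltW.
have := le_powRN s'0 (mulr_gt0 K10 as0) h1.
rewrite powRM ?(ltW K10) ?(ltW as0)// inva -/A => g1.
have := le_powRN s'0 kr0 h2.
rewrite powRM ?(ltW K20) ?(ltW as0)// inva -/B => g2.
set x := k%:R `^ _ in g1 g2 *.
have x0 : 0 <= x by exact: powR_ge0.
split.
  rewrite mulrC ler_pdivrMr; last by lra.
  by apply: (le_trans g1); rewrite mulrC ler_pM2l//; lra.
rewrite -(ler_pM2l B0); apply: (le_trans g2).
rewrite mulrA ler_peMl// mulrDr mulfV ?gt_eqF// lerDr.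
by rewrite mulr_ge0 ?(ltW B0)//; lra.
Qed.

(** * Assembly of the estimates for a system *)

Section Conclusion.
Context {R : realType} {I : finType} (n : I -> nat) (b d : I -> R).
Context (a c : forall i, 'I_(n i) -> R) (E : set (R * R)).
Arguments a : clear implicits.
Arguments c : clear implicits.

Lemma system_gap_estimate (K : set nat) (alpha : nat -> R) :
  system b d a c E -> totally_disconnected E -> gap_sequence E K alpha ->
  exists2 C : R, 1 < C & forall k, K k ->
    C^-1 * k%:R `^ (- (box_dim E)^-1) <= alpha k /\
    alpha k <= C * k%:R `^ (- (box_dim E)^-1).
Proof.
move=> sys td hgap.
have [s1 [t exps]] := sys_exponents sys; have [s10 t0 _ _] := exps.
have cE := sys_compact sys.
have [mu mu0 mu_le] : exists2 mu, 0 < mu & forall i j, mu <= a i j.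
  pose f (w : {i : I & 'I_(n i)}) := a _ (tagged w).
  have [mu mu0 h] : exists2 mu, 0 < mu & forall w, mu <= f w.
    by apply: fin_lbound => w; exact: (sys_a_gt0 sys).
  by exists mu => // i j; exact: (h (Tagged _ j)).
have [K2 K20 cover] := diameter_cover sys exps mu0 mu_le.
have finE delta : 0 < delta -> finite_set (classes E delta).
  move=> d0; have [|N [U [Ud EU _]]] := cover (Num.min delta 2).
    by rewrite lt_min d0 ltr0n ge_min lexx orbT.
  have Ud' i p q : U i p -> U i q -> eucl_dist p q <= delta.
    by move=> Up Uq; apply: le_trans (Ud i p q Up Uq) _; rewrite ge_min lexx.
  by have [] := class_number_cover Ud' EU.
have [K1 K10 low] := class_number_lower sys exps mu0 mu_le finE td.
have up delta : 0 < delta <= 2 ->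
    (class_number E delta)%:R <= cover_number E delta <= K2 * delta `^ (- (s1 + t)).
  move=> d2; have [N [U [Ud EU NK]]] := cover delta d2.
  by have /andP[-> h] := cover_number_le Ud EU; exact: le_trans NK.
have dimE : box_dim E = s1 + t.
  apply: (box_dim_eq K10 K20) => delta /andP[d0 d1].
  have /andP[h1 ->] : (class_number E delta)%:R <= cover_number E delta <=
      K2 * delta `^ (- (s1 + t)) by apply: up; rewrite d0; lra.
  by rewrite andbT (le_trans _ h1)// low.
have one delta : 2 <= delta -> (class_number E delta <= 1)%N.
  move=> d2; have Ud (i : 'I_1) p q : E p -> E q -> eucl_dist p q <= delta.
    move=> Ep Eq; apply: (le_trans (eucl_dist_le_sum _ _)).
    have := sys_unit1 sys Ep; have := sys_unit2 sys Ep.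
    have := sys_unit1 sys Eq; have := sys_unit2 sys Eq => ? ? ? ?.
    apply: le_trans d2; rewrite -[2]/(1 + 1); by apply: lerD; rewrite ler_norml; lra.
  have EU : E `<=` \bigcup_(i in [set: 'I_1]) E by move=> p Ep; exists ord0.
  by have [] := class_number_cover Ud EU.
rewrite dimE; apply: (@gap_estimate _ _ K1 (K2 * 2 `^ (s1 + t))) => //.
- exact: addr_ge0.
- by rewrite mulr_gt0 ?powR_gt0.
move=> k Kk; have a0 := gap_gt0 hgap Kk.
(* From scale 2 on there is exactly one class, so no jump can occur above it. *)
have a2 : alpha k <= 2.
  rewrite leNgt; apply/negP => a2.
  have lt := gap_jump_lt hgap Kk.
  have le : (class_number_left E (alpha k) <= 1)%N.
    apply: leq_trans (one 2 (lexx _)).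
    by apply: class_number_left_le => //; rewrite ltr0n.
  have := lt_le_trans (mulr_gt0 K10 (powR_gt0 (- (s1 + t)) a0)) (low _ a0).
  rewrite ltr0n; case: (class_number E _) lt => // m lt.
  by have := leq_trans lt le.
have a20 : 0 < alpha k / 2 by rewrite divr_gt0.
split.
- exact: (gap_index_gt0 hgap).
- by rewrite a0.
- by apply: le_trans (low _ a0) _; rewrite ler_nat;
     apply: (class_number_le_gap_index cE finE hgap one Kk).
- rewrite -mulrA [2 `^ _ * _]mulrC -powR_divN//.
  have /andP[h1 h2] : (class_number E (alpha k / 2))%:R <= cover_number E (alpha k / 2) <=
      K2 * (alpha k / 2) `^ (- (s1 + t)) by apply: up; rewrite a20; lra.
  apply: le_trans (le_trans h1 h2); rewrite ler_nat.
  apply: leq_trans (gap_index_le finE hgap Kk) _ => //.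
  by apply: class_number_left_le => //; rewrite a20; lra.
Qed.

End Conclusion.

(** * Lalley-Gatzouras sets *)

Section LalleyGatzouras.
Context {R : realType} (m : nat) (n : 'I_m -> nat) (b : 'I_m -> R).
Context (a c : forall i : 'I_m, 'I_(n i) -> R) (E : set (R * R)).
Arguments a : clear implicits.
Arguments c : clear implicits.
Hypothesis hdata : lg_data b a c.

(** With [P] the rows below [i'] it orders the strips; with [P] always true it places them in
    [0, 1]. *)
Lemma lg_offset_le (P : pred 'I_m) i : P i -> (forall k : 'I_m, (k < i)%N -> P k) ->
  lg_offset b i + b i <= \sum_(k | P k) b k.
Proof.
move=> Pi Pk; rewrite [leRHS](bigD1 i)//= [leLHS]addrC lerD2l /lg_offset.
rewrite [leRHS](bigID (fun k : 'I_m => (k < i)%N))/= -[leLHS]addr0 lerD//; last first.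
  by apply: sumr_ge0 => k _; exact: ltW (lg_b_gt0 hdata k).
rewrite le_eqVlt; apply/orP; left; apply/eqP/eq_bigl => k.
have [ki|] := ltnP k i; rewrite ?andbF// andbT Pk//=.
by apply/esym; apply: contraTneq ki => ->; rewrite ltnn.
Qed.

Lemma lg_offset_lt (i i' : 'I_m) : (i < i')%N -> lg_offset b i + b i <= lg_offset b i'.
Proof. by move=> ii'; apply: lg_offset_le => // k /ltn_trans; apply. Qed.

Lemma lg_offset_le1 i : lg_offset b i + b i <= 1.
Proof. by rewrite -(lg_b_sum1 hdata); exact: lg_offset_le. Qed.

Lemma lg_a_gt0 i j : 0 < a i j. Proof. by case: (lg_ab hdata j). Qed.

Lemma lg_c_lt i (j j' : 'I_(n i)) : (j < j')%N -> c i j + a i j <= c i j'.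
Proof.
case: j' => k kn /=; elim: k kn => // k IHk kn.
have kn' : (k < n i)%N by exact: ltnW.
have := @lg_c_step _ _ _ _ _ _ hdata i (Ordinal kn') (Ordinal kn) erefl.
rewrite ltnS leq_eqVlt => step /orP[/eqP jk|jk].
  by have -> : j = Ordinal kn' by [exact: val_inj]; lra.
by have := IHk kn' jk; have := lg_a_gt0 (Ordinal kn'); lra.
Qed.

Lemma lg_c_le1 i (j : 'I_(n i)) : c i j + a i j <= 1.
Proof.
have n0 : (0 < n i)%N by exact: leq_ltn_trans (ltn_ord j).
have last_lt : ((n i).-1 < n i)%N by rewrite prednK.
pose l := Ordinal last_lt.
have := @lg_c_last _ _ _ _ _ _ hdata i l; rewrite prednK// => /(_ erefl) h.
have [jl|lj] := ltnP j l.
  by have := lg_c_lt jl; have := lg_a_gt0 l; lra.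
have -> : j = l by apply/val_inj/anti_leq; rewrite lj -ltnS prednK// ltn_ord.
by lra.
Qed.

Definition lg_row := {i : 'I_m | (0 < n i)%N}.

(** Dropping empty rows leaves the attractor equation unchanged, and the strip of the empty row [i0]
    becomes [sys_strip]. *)
Lemma lg_system : lg_set b a c E -> (exists i : 'I_m, n i = 0%N) ->
  system (fun i : lg_row => b (val i)) (fun i => lg_offset b (val i))
    (fun i => a (val i)) (fun i => c (val i)) E.
Proof.
move=> [E0 cE hE] [i0 ni0].
have row0 (i : lg_row) : val i != i0.
  by apply: contraTneq (valP i) => ->; rewrite ni0.
split=> //.
- by move=> i; exact: (valP i).
- by move=> i j; exact: lg_a_gt0.
- by move=> i j; case: (lg_ab hdata j).
- by move=> i; case: (lg_ab hdata (Ordinal (valP i))).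
- by move=> i j; exact: (lg_c_ge0 hdata).
- by move=> i j; exact: lg_c_le1.
- by move=> i j j'; exact: lg_c_lt.
- by move=> i; apply: sumr_ge0 => k _; exact: ltW (lg_b_gt0 hdata k).
- by move=> i; exact: lg_offset_le1.
- move=> i i' ii'; have /= := neq_ltn (val (val i)) (val (val i')).
  rewrite (inj_eq val_inj) (inj_eq val_inj) ii' => /esym/orP[] lt; [left|right];
    exact: lg_offset_lt.
- exists (lg_offset b i0, lg_offset b i0 + b i0); split=> /=.
  + by apply: sumr_ge0 => k _; exact: ltW (lg_b_gt0 hdata k).
  + by rewrite ltrDl (lg_b_gt0 hdata).
  + exact: lg_offset_le1.
  + move=> i; have := neq_ltn (val (val i)) (val i0).
    rewrite (inj_eq val_inj) row0 => /esym/orP[] lt; [left|right];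
      exact: lg_offset_lt.
- by move=> i; exact: (lg_a_sum hdata).
- rewrite -(lg_b_sum1 hdata) -(big_sub (fun i => 0 < n i)%N b).
  rewrite [leRHS](bigID (fun i => 0 < n i)%N)/= lerDl sumr_ge0// => k _.
  exact: ltW (lg_b_gt0 hdata k).
- move=> p; split.
    rewrite {1}hE => -[i _ [j _ [q Eq <-]]].
    have ni : (0 < n i)%N by exact: leq_ltn_trans (ltn_ord j).
    by exists (Sub i ni), j, q.
  move=> [i [j [q [Eq ->]]]]; rewrite hE.
  by exists (val i) => //; exists j => //; exists q.
Qed.

End LalleyGatzouras.

Theorem theorem1p3 (R : realType) (m : nat) (n : 'I_m -> nat) (b : 'I_m -> R)
    (a c : forall i : 'I_m, 'I_(n i) -> R) (E : set (R * R)%type)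
    (K : set nat) (alpha : nat -> R)
    (hdata : lg_data b a c)
    (hE : lg_set b a c E)
    (htd : totally_disconnected E)
    (hempty : exists i : 'I_m, n i = 0%N)
    (hgap : gap_sequence E K alpha) :
  exists2 C : R, 1 < C & forall k : nat, K k ->
    C^-1 * k%:R `^ (- (box_dim E)^-1) <= alpha k /\
    alpha k <= C * k%:R `^ (- (box_dim E)^-1).
Proof.
exact: (system_gap_estimate (lg_system hdata hE hempty) htd hgap).
Qed.
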